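(* Let $\Bbbk$ be a field of characteristic $0$ and let $A=\Bbbk_{\mathbf p}[x_1,x_2,x_3]$ be a PI skew polynomial ring. Then $A$ is cancellative in the class of connected graded algebras: if $B$ is a connected graded $\Bbbk$-algebra (not necessarily generated in degree one) and $A[t]\cong B[t]$ as algebras, then $A\cong B$.
   Context: For $\mathbf p=(p_{ij})$ with $p_{ii}=1$, $p_{ij}p_{ji}=1$, $\Bbbk_{\mathbf p}[x_1,x_2,x_3]=\Bbbk\langle x_1,x_2,x_3\rangle/(x_jx_i-p_{ij}x_ix_j)$; it is PI iff every $p_{ij}$ is a root of unity. $A[t]$ denotes the polynomial extension by a central indeterminate $t$. *)

(* Defs.v *)
From HB Require Import structures.
From mathcomp Require Import all_boot all_order all_algebra.
Set Implicit Arguments. Unset Strict Implicit. Unset Printing Implicit Defensive.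
Import GRing.Theory.
Local Open Scope ring_scope.

Definition skew_params (k : fieldType) (p : 'I_3 -> 'I_3 -> k) : Prop :=
  (forall i, p i i = 1) /\ (forall i j, p i j * p j i = 1).

Definition skew_rel (k : fieldType) (p : 'I_3 -> 'I_3 -> k)
    (C : algType k) (y : 'I_3 -> C) : Prop :=
  forall i j, y j * y i = p i j *: (y i * y j).

Definition alg_hom (k : fieldType) (A C : algType k) (f : A -> C) : Prop :=
  [/\ forall a b, f (a + b) = f a + f b,
      forall a b, f (a * b) = f a * f b,
      f 1 = 1 &
      forall (c : k) a, f (c *: a) = c *: f a].

(* (A, x) is k_p[x_1,x_2,x_3] = k<x_1,x_2,x_3>/(x_j x_i - p_ij x_i x_j):
   it is presented by the generators x and the relations skew_rel,
   i.e. it has the universal property of this quotient of the free algebra. *)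
Definition is_skew_poly_ring (k : fieldType) (p : 'I_3 -> 'I_3 -> k)
    (A : algType k) (x : 'I_3 -> A) : Prop :=
  skew_rel p x /\
  forall (C : algType k) (y : 'I_3 -> C), skew_rel p y ->
    (exists f : A -> C, alg_hom f /\ forall i, f (x i) = y i) /\
    (forall f g : A -> C, alg_hom f -> alg_hom g ->
       (forall i, f (x i) = g (x i)) -> f =1 g).

(* PI condition for k_p[x_1,x_2,x_3]: every p_ij is a root of unity. *)
Definition roots_of_unity_params (k : fieldType) (p : 'I_3 -> 'I_3 -> k) : Prop :=
  forall i j, exists n : nat, (0 < n)%N /\ p i j ^+ n = 1.

Definition connected_graded (k : fieldType) (B : algType k)
    (V : nat -> B -> Prop) : Prop :=
  [/\ (forall n, V n 0),
      (forall n a b, V n a -> V n b -> V n (a + b)),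
      (forall n (c : k) a, V n a -> V n (c *: a)),
      (forall m n a b, V m a -> V n b -> V (m + n)%N (a * b)) &
    [/\
      (forall b, V 0%N b <-> exists c : k, b = c%:A),
      (forall b, exists (N : nat) (bs : 'I_N -> B),
          (forall i : 'I_N, V i (bs i)) /\ b = \sum_(i < N) bs i) &
      (forall (N : nat) (bs : 'I_N -> B),
          (forall i : 'I_N, V i (bs i)) -> \sum_(i < N) bs i = 0 -> forall i : 'I_N, bs i = 0)]].

Definition alg_iso (k : fieldType) (A B : algType k) : Prop :=
  exists f : A -> B, alg_hom f /\ bijective f.

(* Algebra isomorphism A[t] ~= B[t]; t is central ('X of {poly _}),
   the k-structure on {poly A} is scalar multiplication by (c%:A)%:P. *)
Definition poly_alg_iso (k : fieldType) (A B : algType k) : Prop :=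
  exists f : {poly A} -> {poly B},
    [/\ forall p q, f (p + q) = f p + f q,
        forall p q, f (p * q) = f p * f q,
        f 1 = 1,
        forall (c : k) p, f ((c%:A)%:P * p) = (c%:A)%:P * f p &
        bijective f].

(* Main.v *)
Require Import Defs.
From HB Require Import structures.
From Stdlib Require Import IndefiniteDescription.
From mathcomp Require Import all_boot all_order all_algebra perm zify.
From mathcomp Require Import mpoly.
Set Implicit Arguments. Unset Strict Implicit. Unset Printing Implicit Defensive.
Import GRing.Theory.
Local Open Scope ring_scope.

(** Put [R = A[t]], a skew polynomial ring in four variables [x_i] (with [x_4 = t]
central), let [phi : R -> B[t]] be the isomorphism and bigrade [B[t]] by the degree
of [B] and the degree in [t]. Each [X_i = phi x_i] is normal in the domain [B[t]],
so conjugation by it preserves degrees, and therefore *all* bihomogeneous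
components of the [X_i] satisfy the relations of [R] among themselves. In
particular, if [X_i] has a nonzero constant term then [x_i] is central; translating
such variables we may assume that [phi] respects the augmentations. Expanding the
determinant of the linear parts of the [X_i] multilinearly, we can select one
component [b_i] of each [X_i] so that the [b_i] form a basis of the augmentation
ideal modulo its square. The [b_i] are homogeneous, hence generate [B[t]], and
[x_i |-> b_i] is a surjection [R -> B[t]], which is injective because [R] modulo
the powers of its augmentation ideal is finite dimensional. Exactly one [b_j] is a
multiple of [t] and the other three lie in [B]; as [x_j] is then central, it can be
exchanged with [t], which identifies [A] with [B]. *)

(** * A model of skew polynomial rings *)

Section LinearExtension.
Variables (k : fieldType) (n : nat) (V : lmodType k).
Implicit Types (F : 'X_{1..n} -> V) (f g : {mpoly k[n]}).

Definition lext F f : V := \sum_(u <- msupp f) f@_u *: F u.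

Lemma lextE F f (r : seq 'X_{1..n}) : uniq r -> {subset msupp f <= r} ->
  lext F f = \sum_(u <- r) f@_u *: F u.
Proof.
move=> ur sub; rewrite (bigID (mem (msupp f))) /= [X in _ + X]big1 ?addr0.
  rewrite -big_filter; apply: perm_big; apply: uniq_perm.
  - exact: msupp_uniq.
  - exact: filter_uniq.
  by move=> u; rewrite mem_filter /=; case: (boolP (u \in msupp f)) => // /sub ->.
by move=> u /memN_msupp_eq0 ->; rewrite scale0r.
Qed.

Lemma lextP F c f g : lext F (c *: f + g) = c *: lext F f + lext F g.
Proof.
pose r := undup (msupp f ++ msupp g ++ msupp (c *: f + g)).
have ur : uniq r by exact: undup_uniq.
rewrite !(@lextE F _ r) //; try by move=> u hu; rewrite mem_undup !mem_cat hu ?orbT.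
rewrite scaler_sumr -big_split; apply: eq_bigr => u _ /=.
by rewrite mcoeffD mcoeffZ scalerDl scalerA.
Qed.

HB.instance Definition _ F := GRing.isLinear.Build k {mpoly k[n]} V *:%R (lext F) (lextP F).

Lemma lextX F u : lext F 'X_[u] = F u.
Proof. by rewrite /lext msuppX big_seq1 mcoeffX eqxx scale1r. Qed.

End LinearExtension.

Lemma mpoly_lin_ext (k : fieldType) (n : nat) (P : {mpoly k[n]} -> Prop) :
  P 0 -> (forall c f g, P f -> P g -> P (c *: f + g)) ->
  (forall u, P 'X_[u]) -> forall f, P f.
Proof.
move=> P0 Pl PX f; rewrite (mpolyE f).
elim: (msupp f) => [|u s IH]; first by rewrite big_nil.
by rewrite big_cons; apply: Pl.
Qed.

(** A copy of the commutative polynomials that keeps only their [k]-module structure. The phantom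
    [p] lets the twisted product below depend on the parameters. *)
Definition skewpoly (k : fieldType) (n : nat) (p : 'I_n -> 'I_n -> k) : Type :=
  {mpoly k[n]}.

Section Twist.
Variables (k : fieldType) (n : nat) (p : 'I_n -> 'I_n -> k).

(* Reordering cocycle: X^u X^v = twist u v X^(u+v), with X_j X_i = p i j X_i X_j
   used to move the smaller index i to the left. *)
Definition twist (u v : 'X_{1..n}) : k :=
  \prod_(j < n) \prod_(i < n | (i < j)%N) p i j ^+ (u j * v i).

Lemma twistDl u u' v : twist (u + u')%MM v = twist u v * twist u' v.
Proof.
rewrite /twist -big_split; apply: eq_bigr => j _ /=.
by rewrite -big_split; apply: eq_bigr => i _ /=; rewrite mnmDE mulnDl exprD.
Qed.

Lemma twistDr u v v' : twist u (v + v')%MM = twist u v * twist u v'.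
Proof.
rewrite /twist -big_split; apply: eq_bigr => j _ /=.
by rewrite -big_split; apply: eq_bigr => i _ /=; rewrite mnmDE mulnDr exprD.
Qed.

Lemma twist0l v : twist 0%MM v = 1.
Proof. by rewrite /twist big1 // => j _; rewrite big1 // => i _; rewrite mnm0E. Qed.

Lemma twist0r u : twist u 0%MM = 1.
Proof.
by rewrite /twist big1 // => j _; rewrite big1 // => i _; rewrite mnm0E muln0.
Qed.

Lemma twist_neq0 u v : (forall i j, p i j != 0) -> twist u v != 0.
Proof.
move=> p0; apply/prodf_neq0 => j _; apply/prodf_neq0 => i _.
exact: expf_neq0.
Qed.

Lemma twistU i v : twist U_(i)%MM v = \prod_(j < n | (j < i)%N) p j i ^+ v j.
Proof.
rewrite /twist (bigD1 i) //= [X in _ * X]big1 ?mulr1.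
  by apply: eq_bigr => j _; rewrite mnm1E eqxx mul1n.
by move=> j ne; rewrite big1 // => l _; rewrite mnm1E eq_sym (negPf ne) expr0.
Qed.

Lemma twistUU i j : twist U_(i)%MM U_(j)%MM = if (j < i)%N then p j i else 1.
Proof.
rewrite twistU; case: ifP => ji.
  rewrite (bigD1 j) //= [X in _ * X]big1 ?mulr1 ?mnm1E ?eqxx ?expr1 //.
  by move=> l /andP[_ ne]; rewrite mnm1E eq_sym (negPf ne).
rewrite big1 // => l li; rewrite mnm1E.
by case: eqP => // e; rewrite e li in ji.
Qed.

Local Notation sk := (skewpoly p).
HB.instance Definition _ := GRing.Lmodule.on sk.

Definition smul (f g : sk) : sk :=
  lext (fun u => lext (fun v => twist u v *: 'X_[(u + v)%MM]) g) f.

Lemma smulPl c f f' g : smul (c *: f + f') g = c *: smul f g + smul f' g.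
Proof. by rewrite /smul linearP. Qed.

Lemma smulPr c f g g' : smul f (c *: g + g') = c *: smul f g + smul f g'.
Proof.
rewrite /smul /lext scaler_sumr -big_split; apply: eq_bigr => u _ /=.
by rewrite -![\sum_(i <- msupp _) _]/(lext _ _) linearP scalerDr !scalerA mulrC.
Qed.

Lemma smulXX u v : smul 'X_[u] 'X_[v] = twist u v *: 'X_[(u + v)%MM].
Proof. by rewrite /smul !lextX. Qed.

Lemma smul0l g : smul 0 g = 0.
Proof. by rewrite /smul linear0. Qed.

Lemma smul0r f : smul f 0 = 0.
Proof.
by rewrite /smul /lext big1 // => u _; rewrite -[X in _ *: X]/(lext _ 0) linear0 scaler0.
Qed.

(** By trilinearity it suffices to treat monomials, where associativity is the cocycle identity for
    [twist], a consequence of its bimultiplicativity. *)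
Lemma smulA : associative smul.
Proof.
move=> f g h; elim/mpoly_lin_ext: f => [|c f f' Hf Hf'|u].
- by rewrite !smul0l.
- by rewrite !smulPl Hf Hf'.
elim/mpoly_lin_ext: g => [|c g g' Hg Hg'|v].
- by rewrite smul0l !smul0r smul0l.
- by rewrite smulPl !smulPr smulPl Hg Hg'.
elim/mpoly_lin_ext: h => [|c h h' Hh Hh'|w].
- by rewrite !smul0r.
- by rewrite !smulPr Hh Hh'.
rewrite !smulXX -[_ *: 'X_[(v + w)%MM]]addr0 smulPr smul0r addr0.
rewrite -[_ *: 'X_[(u + v)%MM]]addr0 smulPl smul0l addr0 !smulXX !scalerA.
by rewrite twistDl twistDr addmA mulrC -mulrA.
Qed.

Lemma smul1l : left_id (1 : {mpoly k[n]}) smul.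
Proof.
move=> g; elim/mpoly_lin_ext: g => [|c g g' Hg Hg'|v].
- exact: smul0r.
- by rewrite smulPr Hg Hg'.
by rewrite -[1]mpolyX0 smulXX twist0l add0m scale1r.
Qed.

Lemma smul1r : right_id (1 : {mpoly k[n]}) smul.
Proof.
move=> g; elim/mpoly_lin_ext: g => [|c g g' Hg Hg'|v].
- exact: smul0l.
- by rewrite smulPl Hg Hg'.
by rewrite -[X in smul _ X]mpolyX0 smulXX twist0r addm0 scale1r.
Qed.

Lemma smulDl : left_distributive smul +%R.
Proof. by move=> f f' g; have := smulPl 1 f f' g; rewrite !scale1r. Qed.

Lemma smulDr : right_distributive smul +%R.
Proof. by move=> f g g'; have := smulPr 1 f g g'; rewrite !scale1r. Qed.

Lemma skew_oner_neq0 : (1 : {mpoly k[n]}) != 0 :> sk.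
Proof. exact: (@oner_neq0 {mpoly k[n]}). Qed.

HB.instance Definition _ := GRing.Zmodule_isNzRing.Build sk
  smulA smul1l smul1r smulDl smulDr skew_oner_neq0.

Lemma skew_scalerAl c (f g : sk) : c *: (f * g) = (c *: f : sk) * g.
Proof.
have := smulPl c f 0 g; rewrite smul0l !addr0. by move=> <-.
Qed.

HB.instance Definition _ := GRing.Lmodule_isLalgebra.Build k sk skew_scalerAl.

Lemma skew_scalerAr c (f g : sk) : c *: (f * g) = f * (c *: g : sk).
Proof.
by have := smulPr c f g 0; rewrite smul0r !addr0.
Qed.

HB.instance Definition _ := GRing.Lalgebra_isAlgebra.Build k sk skew_scalerAr.

Definition skewX (u : 'X_{1..n}) : sk := 'X_[u].

Lemma skewXM u v : skewX u * skewX v = twist u v *: skewX (u + v)%MM.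
Proof. exact: smulXX. Qed.

Lemma skewX0 : skewX 0%MM = 1.
Proof. exact: mpolyX0. Qed.

Lemma skew_lin_ind (P : sk -> Prop) :
  P 0 -> (forall c f g, P f -> P g -> P (c *: f + g)) ->
  (forall u, P (skewX u)) -> forall f, P f.
Proof. exact: mpoly_lin_ext. Qed.

End Twist.
Arguments skewX {k n} p u.
Arguments twist {k n} p u v.

Lemma mnm_ind n (P : 'X_{1..n} -> Prop) :
  P 0%MM -> (forall i u, P u -> P (U_(i) + u)%MM) -> forall u, P u.
Proof.
move=> P0 PU u; have [m] := ubnP (mdeg u); elim: m u => // m IH u um.
case: (u =P 0%MM) => [->//|/eqP u0].
have /existsP[i ui] : [exists i, u i != 0%N].
  apply: contraR u0 => /existsPn h; apply/eqP/mnmP => i.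
  by rewrite mnm0E; apply/eqP; have := h i; rewrite negbK.
have e : (U_(i) + (u - U_(i)) = u)%MM by rewrite addmC submK // lep1mP.
rewrite -e; apply/PU/IH; move: um; rewrite -{1}e mdegD mdeg1 add1n ltnS.
exact.
Qed.

Definition q_params n (k : fieldType) (p : 'I_n -> 'I_n -> k) : Prop :=
  (forall i, p i i = 1) /\ (forall i j, p i j * p j i = 1).

Definition q_rel n (k : fieldType) (p : 'I_n -> 'I_n -> k)
    (C : algType k) (y : 'I_n -> C) : Prop :=
  forall i j, y j * y i = p i j *: (y i * y j).

Lemma q_params_neq0 n (k : fieldType) (p : 'I_n -> 'I_n -> k) :
  q_params p -> forall i j, p i j != 0.
Proof.
move=> [_ h] i j; apply/eqP => e; have := h i j.
by rewrite e mul0r => /esym/eqP; rewrite oner_eq0.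
Qed.

Section AlgHom.
Variables (k : fieldType) (A C : algType k) (f : A -> C).
Hypothesis hf : alg_hom f.

Lemma alg_homD a b : f (a + b) = f a + f b. Proof. by case: hf. Qed.
Lemma alg_homM a b : f (a * b) = f a * f b. Proof. by case: hf. Qed.
Lemma alg_hom1 : f 1 = 1. Proof. by case: hf. Qed.
Lemma alg_homZ c a : f (c *: a) = c *: f a. Proof. by case: hf. Qed.
Lemma alg_hom0 : f 0 = 0. Proof. by rewrite -(scale0r 0) alg_homZ scale0r. Qed.
Lemma alg_homN a : f (- a) = - f a.
Proof. by rewrite -scaleN1r alg_homZ scaleN1r. Qed.
Lemma alg_homB a b : f (a - b) = f a - f b.
Proof. by rewrite alg_homD alg_homN. Qed.
Lemma alg_hom_sum I (r : seq I) (P : pred I) F :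
  f (\sum_(i <- r | P i) F i) = \sum_(i <- r | P i) f (F i).
Proof. exact: (big_morph f alg_homD alg_hom0). Qed.
End AlgHom.

Lemma alg_hom_comp (k : fieldType) (A C D : algType k) (f : A -> C) (g : C -> D) :
  alg_hom f -> alg_hom g -> alg_hom (g \o f).
Proof.
move=> hf hg; split=> [a b|a b||c a] /=.
- by rewrite (alg_homD hf) (alg_homD hg).
- by rewrite (alg_homM hf) (alg_homM hg).
- by rewrite (alg_hom1 hf) (alg_hom1 hg).
- by rewrite (alg_homZ hf) (alg_homZ hg).
Qed.

(** * Generators and universal property of the model *)

Section Generators.
Variables (k : fieldType) (n : nat) (p : 'I_n -> 'I_n -> k).
Hypothesis hp : q_params p.

Definition skew_gen (i : 'I_n) : skewpoly p := skewX p U_(i)%MM.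

Lemma twist_unit u v : twist p u v != 0.
Proof. by apply: twist_neq0; apply: q_params_neq0. Qed.

Lemma skewX_split i u :
  skewX p (U_(i) + u)%MM = (twist p U_(i)%MM u)^-1 *: (skew_gen i * skewX p u).
Proof. by rewrite skewXM scalerA mulVf ?twist_unit // scale1r. Qed.

Lemma skew_gen_rel : q_rel p skew_gen.
Proof.
case: hp => p1 pV i j; rewrite /skew_gen !skewXM !twistUU scalerA [(U_(j) + _)%MM]addmC.
by case: (ltngtP i j) => [ij|ij|/val_inj->]; rewrite ?mulr1 ?pV ?p1.
Qed.

Lemma skew_ind (P : skewpoly p -> Prop) :
  P 1 -> (forall c f g, P f -> P g -> P (c *: f + g)) ->
  (forall i f, P f -> P (skew_gen i * f)) -> forall f, P f.
Proof.
move=> P1 Pl PM.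
have P0 : P 0 by have := Pl (-1) 1 1 P1 P1; rewrite scaleN1r addNr.
apply: skew_lin_ind => // u.
elim/mnm_ind: u => [|i u Pu]; first by rewrite skewX0.
by rewrite skewX_split -[_ *: _]addr0; apply: Pl => //; apply: PM.
Qed.

Lemma skew_hom_eq (C : algType k) (f g : skewpoly p -> C) : alg_hom f -> alg_hom g ->
  (forall i, f (skew_gen i) = g (skew_gen i)) -> f =1 g.
Proof.
move=> hf hg e; apply: skew_ind => [|c a b Ha Hb|i a Ha].
- by rewrite (alg_hom1 hf) (alg_hom1 hg).
- by rewrite (alg_homD hf) (alg_homD hg) (alg_homZ hf) (alg_homZ hg) Ha Hb.
- by rewrite (alg_homM hf) (alg_homM hg) e Ha.
Qed.

Section Eval.
Variables (C : algType k) (y : 'I_n -> C).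
Hypothesis hy : q_rel p y.

(** [enum 'I_n] is increasing, so the factors stand in the normal order relative to which [twist]
    measures reordering. *)
Definition qmon (u : 'X_{1..n}) : C := \prod_(i <- enum 'I_n) y i ^+ u i.
Definition skew_eval (f : skewpoly p) : C := lext qmon f.

Lemma q_relX i j m : y i * y j ^+ m = p j i ^+ m *: (y j ^+ m * y i).
Proof.
elim: m => [|m IH]; first by rewrite !expr0 mulr1 mul1r scale1r.
rewrite exprS mulrA hy -scalerAl -[y j * y i * _]mulrA IH -scalerAr scalerA.
by rewrite mulrA !exprS.
Qed.

(** The new factor moves right past the smaller indices, each contributing a power of its parameter,
    until it merges with its own power; sortedness leaves only larger indices beyond. *)
Lemma q_rel_prod i (l : seq 'I_n) (v : 'X_{1..n}) :
  sorted (fun a b : 'I_n => (a < b)%N) l -> i \in l ->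
  y i * \prod_(j <- l) y j ^+ v j =
  (\prod_(j <- l | (j < i)%N) p j i ^+ v j) *:
    \prod_(j <- l) y j ^+ (U_(i) + v)%MM j.
Proof.
elim: l => // a l IH sl; rewrite inE.
have al : all (fun b : 'I_n => (a < b)%N) l.
  by apply: order_path_min sl => x z t; apply: ltn_trans.
rewrite !big_cons mnmDE mnm1E; case: (i =P a) => [ia _|ia /= il].
  subst a; rewrite ltnn mulrA -exprS add1n.
  rewrite [X in X *: _]big1_seq ?scale1r.
    congr (_ * _); apply: eq_big_seq => j jl; rewrite mnmDE mnm1E.
    by have /= := allP al j jl; case: eqP => [<-|//]; rewrite ltnn.
  move=> j /andP[ji jl]; have := allP al j jl.
  by rewrite /= ltnNge leq_eqVlt ji orbT.
rewrite add0n (allP al i il) mulrA q_relX -scalerAl -mulrA.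
by rewrite IH ?(path_sorted sl) // -scalerAr scalerA.
Qed.

Lemma qmonU i v : y i * qmon v = twist p U_(i)%MM v *: qmon (U_(i) + v)%MM.
Proof.
rewrite /qmon q_rel_prod ?mem_enum //; last first.
  by have := iota_ltn_sorted 0 n; rewrite -val_enum_ord sorted_map.
by rewrite twistU big_enum_cond.
Qed.

Lemma qmon0 : qmon 0%MM = 1.
Proof. by rewrite /qmon big1 // => i _; rewrite mnm0E. Qed.

Lemma qmonM u v : qmon u * qmon v = twist p u v *: qmon (u + v)%MM.
Proof.
elim/mnm_ind: u => [|i u IH]; first by rewrite qmon0 twist0l add0m mul1r scale1r.
have e : qmon (U_(i) + u)%MM = (twist p U_(i)%MM u)^-1 *: (y i * qmon u).
  by rewrite qmonU scalerA mulVf ?twist_unit // scale1r.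
rewrite e -scalerAl -mulrA IH -scalerAr qmonU !scalerA twistDr addmA twistDl.
congr (_ *: _); rewrite -mulrA; apply: (canLR (mulKf (twist_unit _ _))).
by rewrite mulrCA mulrA [_ * twist p u v]mulrC !mulrA.
Qed.

Lemma skew_eval_hom : alg_hom skew_eval.
Proof.
have hX u : skew_eval (skewX p u) = qmon u by rewrite /skew_eval lextX.
have hl c f g : skew_eval (c *: f + g) = c *: skew_eval f + skew_eval g.
  exact: linearP.
have h0 : skew_eval 0 = 0 by exact: linear0.
split.
- by move=> f g; have := hl 1 f g; rewrite !scale1r.
- move=> f g.
  elim/skew_lin_ind: f => [|c f f' Hf Hf'|u]; first by rewrite h0 !mul0r h0.
    by rewrite mulrDl -scalerAl !hl Hf Hf' mulrDl scalerAl.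
  elim/skew_lin_ind: g => [|c g g' Hg Hg'|v]; first by rewrite h0 !mulr0 h0.
    by rewrite mulrDr -scalerAr !hl Hg Hg' mulrDr scalerAr.
  by rewrite skewXM -[_ *: _]addr0 hl h0 addr0 !hX qmonM.
- by rewrite -(skewX0 p) hX qmon0.
- by move=> c f; have := hl c f 0; rewrite h0 !addr0.
Qed.

Lemma skew_eval_gen i : skew_eval (skew_gen i) = y i.
Proof.
rewrite /skew_eval lextX -[U_(i)%MM]addm0.
have := qmonU i 0; rewrite qmon0 mulr1 => ->.
by rewrite twist0r scale1r.
Qed.

End Eval.

Lemma skew_gen_normal i (f : skewpoly p) : exists g, skew_gen i * f = g * skew_gen i.
Proof.
elim/skew_ind: f => [|c f f' [g Hg] [g' Hg']|j f [g Hg]].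
- by exists 1; rewrite mulr1 mul1r.
- by exists (c *: g + g'); rewrite mulrDr mulrDl -scalerAr Hg Hg' scalerAl.
- exists (p j i *: skew_gen j * g).
  by rewrite mulrA skew_gen_rel -scalerAl -mulrA Hg scalerAl mulrA.
Qed.

End Generators.

(** * Coefficients, the domain property and the filtration by order *)

Section Coefficients.
Variables (k : fieldType) (n : nat) (p : 'I_n -> 'I_n -> k).
Hypothesis hp : q_params p.
Local Notation sk := (skewpoly p).

Definition scoef (u : 'X_{1..n}) (f : sk) : k := mcoeff u f.

Lemma scoefP u c (f g : sk) : scoef u (c *: f + g) = c * scoef u f + scoef u g.
Proof. by rewrite /scoef mcoeffD mcoeffZ. Qed.

Lemma scoef0 u : scoef u 0 = 0. Proof. exact: mcoeff0. Qed.

Lemma scoefD u (f g : sk) : scoef u (f + g) = scoef u f + scoef u g.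
Proof. exact: mcoeffD. Qed.

Lemma scoefZ u c (f : sk) : scoef u (c *: f) = c * scoef u f.
Proof. exact: mcoeffZ. Qed.

Lemma scoefB u (f g : sk) : scoef u (f - g) = scoef u f - scoef u g.
Proof. exact: mcoeffB. Qed.

Lemma scoef_sum u I (r : seq I) (P : pred I) (F : I -> sk) :
  scoef u (\sum_(i <- r | P i) F i) = \sum_(i <- r | P i) scoef u (F i).
Proof. exact: (big_morph _ (scoefD u) (scoef0 u)). Qed.

Lemma scoefX u v : scoef u (skewX p v) = (v == u)%:R.
Proof. exact: mcoeffX. Qed.

Lemma scoef_gen u i : scoef u (skew_gen p i) = (U_(i)%MM == u)%:R.
Proof. exact: scoefX. Qed.

Lemma scoef1 u : scoef u 1 = (0%MM == u)%:R.
Proof. by rewrite -(skewX0 p) scoefX. Qed.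

Lemma scoef_eq0 (f : sk) : (forall u, scoef u f = 0) -> f = 0.
Proof. by move=> h; apply/mpolyP => u; rewrite mcoeff0; apply: h. Qed.

Lemma skew_expand (f : sk) : f = \sum_(u <- msupp f) scoef u f *: skewX p u.
Proof. exact: mpolyE. Qed.

Lemma skewM_expand (f g : sk) : f * g =
  \sum_(u <- msupp f) \sum_(v <- msupp g)
     (scoef u f * scoef v g * twist p u v) *: skewX p (u + v)%MM.
Proof.
rewrite {1}[f]skew_expand mulr_suml; apply: eq_bigr => u _.
rewrite {1}[g]skew_expand mulr_sumr; apply: eq_bigr => v _.
by rewrite -scalerAr -scalerAl skewXM !scalerA [_ * scoef u f]mulrC.
Qed.

(** For the monomial order, the leading coefficient of a product is the product of the leading
    coefficients times a value of [twist], which is nonzero. *)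
Lemma skew_integral (f g : sk) : f * g = 0 -> f = 0 \/ g = 0.
Proof.
move=> fg; case: (eqVneq f 0) => [|f0]; [by left | right].
case: (eqVneq g 0) => // g0.
pose a := mlead f; pose b := mlead g.
have : scoef (a + b)%MM (f * g) = scoef a f * scoef b g * twist p a b.
  rewrite skewM_expand scoef_sum (bigD1_seq a) ?msupp_uniq ?mlead_supp //=.
  rewrite [X in _ + X]big1_seq ?addr0; last first.
    move=> u /andP[ua uf]; rewrite scoef_sum big1_seq // => v /andP[_ vg].
    rewrite scoefZ scoefX; case: eqP => [e|_]; last by rewrite mulr0.
    have lu : (u < a)%O by rewrite Order.POrderTheory.lt_neqAle ua msupp_le_mlead.
    have := ltmc_le_add lu (msupp_le_mlead vg).
    by rewrite e Order.POrderTheory.ltxx.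
  rewrite scoef_sum (bigD1_seq b) ?msupp_uniq ?mlead_supp //=.
  rewrite [X in _ + X]big1_seq ?addr0.
    by rewrite scoefZ scoefX eqxx mulr1.
  by move=> v /andP[vb vg]; rewrite scoefZ scoefX eqm_add2l (negPf vb) mulr0.
rewrite fg scoef0 => /esym/eqP; rewrite !mulf_eq0 (negPf (twist_unit hp a b)) orbF.
by rewrite !mleadc_eq0 (negPf f0) (negPf g0).
Qed.

(** This is membership in the [d]-th power of the augmentation ideal, which is spanned by the
    monomials of degree at least [d]. *)
Definition sord d (f : sk) := forall u, (mdeg u < d)%N -> scoef u f = 0.

Lemma sord_le d e (f : sk) : (d <= e)%N -> sord e f -> sord d f.
Proof. by move=> de h u ud; apply: h; apply: leq_trans de. Qed.

Lemma sord1 (f : sk) : scoef 0%MM f = 0 -> sord 1 f.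
Proof. by move=> h u; rewrite ltnS leqn0 mdeg_eq0 => /eqP->. Qed.

Lemma sordP d c (f g : sk) : sord d f -> sord d g -> sord d (c *: f + g).
Proof. by move=> hf hg u ud; rewrite scoefP hf // hg // mulr0 addr0. Qed.

Lemma sord_zero d : sord d 0. Proof. by move=> u _; apply: scoef0. Qed.

Lemma sordZ d c (f : sk) : sord d f -> sord d (c *: f).
Proof. by move=> h; rewrite -[_ *: _]addr0; apply: sordP => //; apply: sord_zero. Qed.

Lemma sord_sum d I (r : seq I) (P : pred I) (F : I -> sk) :
  (forall i, P i -> sord d (F i)) -> sord d (\sum_(i <- r | P i) F i).
Proof. by move=> h u ud; rewrite scoef_sum big1 // => i Pi; apply: h. Qed.

Lemma sordM d e (f g : sk) : sord d f -> sord e g -> sord (d + e) (f * g).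
Proof.
move=> hf hg w wd; rewrite skewM_expand scoef_sum big1_seq // => u _.
rewrite scoef_sum big1_seq // => v _; rewrite scoefZ scoefX.
case: eqP => [e'|_]; last by rewrite mulr0.
have [ud|du] := ltnP (mdeg u) d; first by rewrite hf // !mul0r.
have [ve|ev] := ltnP (mdeg v) e; first by rewrite hg // mulr0 !mul0r.
by move: wd; rewrite -e' mdegD ltnNge leq_add.
Qed.

Lemma sord_gen i : sord 1 (skew_gen p i).
Proof. by apply: sord1; rewrite scoef_gen mnm1_eq0. Qed.

Lemma qmon_sord (y : 'I_n -> sk) u :
  q_rel p y -> (forall i, sord 1 (y i)) -> sord (mdeg u) (qmon y u).
Proof.
move=> hy y1; elim/mnm_ind: u => [|i u IH]; first by rewrite mdeg0.
have := qmonU hy i u; rewrite mdegD mdeg1 => e.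
have : sord (1 + mdeg u) (y i * qmon y u) by apply: sordM.
rewrite e => /(@sordZ _ (twist p U_(i)%MM u)^-1).
by rewrite scalerA mulVf ?twist_unit // scale1r.
Qed.

Lemma q_rel_hom (A C : algType k) (f : A -> C) (y : 'I_n -> A) :
  alg_hom f -> q_rel p y -> q_rel p (f \o y).
Proof.
by move=> hf hy i j; rewrite /= -!(alg_homM hf) hy (alg_homZ hf).
Qed.

Section Hopfian.
Variable h : sk -> sk.
Hypotheses (hh : alg_hom h) (h1 : forall i, sord 1 (h (skew_gen p i))).

Lemma hom_skewX u : h (skewX p u) = qmon (h \o skew_gen p) u.
Proof.
have hr : q_rel p (h \o skew_gen p) by apply: q_rel_hom => //; apply: skew_gen_rel.
rewrite (skew_hom_eq hp hh (skew_eval_hom hp hr)); first by rewrite /skew_eval lextX.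
by move=> i; rewrite skew_eval_gen.
Qed.

Lemma hom_sord d f : sord d f -> sord d (h f).
Proof.
move=> hf; rewrite [f]skew_expand (alg_hom_sum hh); apply: sord_sum => u _.
rewrite (alg_homZ hh) hom_skewX.
have [ud|du] := ltnP (mdeg u) d; first by rewrite hf // scale0r; apply: sord_zero.
apply/sordZ/(sord_le du)/qmon_sord => //.
by apply: q_rel_hom => //; apply: skew_gen_rel.
Qed.

(** By [hom_sord], [h] acts on the finite-dimensional quotients by powers of the augmentation ideal.
    There a surjection is invertible, and [r] survives in a quotient of large enough order. *)
Lemma skew_hopfian : (forall w, exists r, h r = w) ->
  forall r, h r = 0 -> r = 0.
Proof.
(* Every monomial of [r] has degree below [msize r], so truncation at [N] loses nothing of [r]. *)
move=> sur r hr0; pose N := msize r.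
pose J : finType := 'X_{1..n < N}.
pose ev (i : 'I_#|J|) : 'X_{1..n} := (enum_val i : J).
have evI : injective ev by move=> i j /val_inj/enum_val_inj.
have evJ u : (mdeg u < N)%N -> exists i, ev i = u.
  by move=> uN; exists (enum_rank (BMultinom uN : J)); rewrite /ev enum_rankK.
have evN i : (mdeg (ev i) < N)%N by apply: bmdeg.
pose H : 'M[k]_#|J| := \matrix_(i, j) scoef (ev j) (h (skewX p (ev i))).
(* The part of [f] of order [N] is sent to order [N], so it does not affect the coefficients in
   lower degrees. *)
have hE f j : scoef (ev j) (h f) = \sum_i scoef (ev i) f * H i j.
  pose f1 : sk := \sum_i scoef (ev i) f *: skewX p (ev i).
  have f2 : sord N (f - f1).
    move=> u /evJ[i <-]; rewrite scoefB scoef_sum (bigD1 i) //= scoefZ scoefX eqxx.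
    rewrite mulr1 big1 ?addr0 ?subrr // => l li.
    by rewrite scoefZ scoefX (inj_eq evI) (negPf li) mulr0.
  have := hom_sord f2 (evN j); rewrite (alg_homB hh) scoefB => /eqP.
  rewrite subr_eq0 => /eqP->; rewrite (alg_hom_sum hh) scoef_sum.
  by apply: eq_bigr => i _; rewrite (alg_homZ hh) scoefZ mxE.
have [g Hg] := fin_all_exists (fun i => sur (skewX p (ev i))).
pose G : 'M[k]_#|J| := \matrix_(i, j) scoef (ev j) (g i).
(* Preimages of the monomials are the rows of a left inverse of [H], two-sided because the matrices
   are square. *)
have GH : G *m H = 1%:M.
  apply/matrixP => i j; rewrite !mxE.
  under eq_bigr => l _ do rewrite mxE.
  by rewrite -hE Hg scoefX (inj_eq evI).
pose c : 'rV[k]_#|J| := \row_i scoef (ev i) r.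
have cH : c *m H = 0.
  apply/rowP => j; rewrite !mxE.
  under eq_bigr => l _ do rewrite mxE.
  by rewrite -hE hr0 scoef0.
have c0 : c = 0 by rewrite -[c]mulmx1 -(mulmx1C GH) mulmxA cH mul0mx.
apply: scoef_eq0 => u; have [uN|Nu] := ltnP (mdeg u) N.
  have [i <-] := evJ u uN; have := congr1 (fun M : 'rV_#|J| => M 0 i) c0.
  by rewrite !mxE.
exact/memN_msupp_eq0/msize_mdeg_ge.
Qed.

End Hopfian.
End Coefficients.

(** * Normal elements of graded domains *)

Definition integral_ring (D : nzRingType) := forall a b : D, a * b = 0 -> a = 0 \/ b = 0.

(** For nonzero [a] in a domain [b'] is unique, so this is conjugation by [a] without an inverse of
    [a]. *)
Definition normal_elt (D : nzRingType) (a : D) := forall b, exists b', a * b = b' * a.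

Section PolyNormal.
Variable D : nzRingType.
Hypothesis hD : integral_ring D.

Lemma integral_neq0 (a b : D) : a != 0 -> b != 0 -> a * b != 0.
Proof. by move=> a0 b0; apply/eqP => /hD[] /eqP; apply/negP. Qed.

Lemma poly_integral : integral_ring {poly D}.
Proof.
move=> F G FG; case: (eqVneq F 0) => [|F0]; [by left | right].
case: (eqVneq G 0) => // G0.
have h : lead_coef F * lead_coef G != 0 by apply: integral_neq0; rewrite lead_coef_eq0.
by have := lead_coef_proper_mul h; rewrite FG lead_coef0 => e; rewrite -e eqxx in h.
Qed.

(** For nonzero [y], comparing the highest and the lowest degrees of both sides forces [G] to be a
    monomial of degree [e]. *)
Lemma monomial_conj (F G : {poly D}) y e : F != 0 -> F * (y%:P * 'X^e) = G * F ->
  exists g, G = g%:P * 'X^e /\ F * y%:P = g%:P * F.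
Proof.
move=> F0 FG; case: (eqVneq y 0) => [y0|y0].
  exists 0; rewrite y0 !mul0r mulr0; split => //.
  move: FG; rewrite y0 mul0r mulr0 => /esym/poly_integral[->//|/eqP].
  by rewrite (negPf F0).
have yX0 : y%:P * 'X^e != 0 :> {poly D}.
  by rewrite -size_poly_eq0 size_mulXn ?polyC_eq0 // size_polyC y0 addn1.
have G0 : G != 0.
  apply: contraNneq yX0 => G0; move: FG; rewrite G0 mul0r => /poly_integral[/eqP|->//].
  by rewrite (negPf F0).
have sG : size G = e.+1.
  have := congr1 (fun P : {poly D} => size P) FG.
  rewrite [LHS]size_proper_mul ?[RHS]size_proper_mul ?integral_neq0 ?lead_coef_eq0 //.
  rewrite size_mulXn ?polyC_eq0 // size_polyC y0 addn1.
  have := F0; have := G0; rewrite -!size_poly_gt0.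
  case: (size F) => // a; case: (size G) => // b _ _.
  by rewrite addSn addSn /= [(b + _)%N]addnC addnS addSn => /eqP; rewrite eqSS eqn_add2l => /eqP->.
have [l Fl lmin] : exists2 l, F`_l != 0 & forall i, (i < l)%N -> F`_i = 0.
  have ex : exists l, F`_l != 0 by exists (size F).-1; rewrite -lead_coefE lead_coef_eq0.
  case: (ex_minnP ex) => l Fl lmin; exists l => // i il.
  by apply: contraTeq il => /lmin; rewrite leqNgt.
(* The left side of [FG] has no terms below degree [l + e]. By induction, the coefficient of degree
   [j + l] on the right reduces to the [j]-th coefficient of [G] times the lowest one of [F]. *)
have Glow j : (j < e)%N -> G`_j = 0.
  have [m] := ubnP j; elim: m j => // m IH j jm je.
  have := congr1 (fun P : {poly D} => P`_(j + l)) FG.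
  rewrite mulrA coefMXn [RHS]coefM.
  have jl : (j < (j + l).+1)%N by rewrite ltnS leq_addr.
  rewrite (bigD1 (Ordinal jl)) //= addKn big1 ?addr0; last first.
    move=> i; rewrite -val_eqE /= neq_ltn => /orP[ij|ji].
      by rewrite IH ?mul0r // ?(ltn_trans ij je) // (leq_trans ij).
    by rewrite lmin ?mulr0 // ltn_subLR ?leq_ord // ltn_add2r.
  have -> : (if (j + l < e)%N then 0 else (F * y%:P)`_(j + l - e)) = 0 :> D.
    case: ltnP => // ejl; rewrite coefMC lmin ?mul0r //.
    by rewrite ltn_subLR // ltn_add2r.
  by move=> /esym/hD[->//|/eqP]; rewrite (negPf Fl).
have eG : G = (G`_e)%:P * 'X^e.
  apply/polyP => i; rewrite coefCM coefXn.
  case: (ltngtP i e) => [ie|ie|->]; rewrite ?mulr1 ?mulr0 //; first exact: Glow.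
  by rewrite nth_default // sG.
exists G`_e; split => //.
apply/polyP => i; have := congr1 (fun P : {poly D} => P`_(i + e)) FG.
rewrite {1}eG mulrA coefMXn -[_ * 'X^e * F]mulrA -commr_polyXn mulrA coefMXn.
by rewrite ltnNge leq_addl /= addnK.
Qed.

(** Conjugation by [F] preserves constants and fixes ['X], so it acts on [G] coefficientwise.
    Reading off degree [d] in the relations for constants shows that each nonzero coefficient of [F]
    induces the same conjugation. *)
Lemma normal_coef (F G H : {poly D}) :
  (forall y, exists g, F * y%:P = g%:P * F) -> F * G = H * F ->
  forall d e, F`_d * G`_e = H`_e * F`_d.
Proof.
move=> nF FG d; case: (eqVneq F 0) => [->|F0 e].
  by move=> e; rewrite coef0 mul0r mulr0.
have {FG} [H' [FG ->]] : exists H' : {poly D}, F * G = H' * F /\ H = H'.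
  by exists H.
have : exists K : {poly D}, F * G = K * F /\ forall e, F`_d * G`_e = K`_e * F`_d.
  elim/poly_ind: {FG} G => [|G c [K [GK cK]]].
    by exists 0; rewrite mulr0 mul0r; split => // i; rewrite !coef0 mulr0 mul0r.
  have [g Fg] := nF c; exists (K * 'X + g%:P); split.
    by rewrite mulrDr mulrDl Fg mulrA GK -!mulrA -commr_polyX.
  move=> [|i]; rewrite !coefD !coefMX !coefC /= ?add0r ?addr0 //.
  by have := congr1 (fun P : {poly D} => P`_d) Fg; rewrite coefMC coefCM.
(* Cancelling [F] identifies the given conjugate of [G] with the one built coefficientwise. *)
case=> K [FK ->]; suff -> : H' = K by [].
apply/eqP; rewrite -subr_eq0; apply/eqP.
have /poly_integral[//|/eqP] : (H' - K) * F = 0 by rewrite mulrBl -FK -FG subrr.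
by rewrite (negPf F0).
Qed.

Lemma normal_polyC (F : {poly D}) : normal_elt F ->
  forall y, exists g, F * y%:P = g%:P * F.
Proof.
move=> nF y; case: (eqVneq F 0) => [->|F0]; first by exists 0; rewrite mul0r mulr0.
have [G FG] := nF y%:P; case: (@monomial_conj F G y 0 F0).
  by rewrite expr0 mulr1.
by move=> g [_ ->]; exists g.
Qed.

End PolyNormal.

(** * Connected gradings and conjugation by normal elements *)

Section Grading.
Variables (k : fieldType) (B : algType k) (V : nat -> B -> Prop).
Hypothesis hB : connected_graded V.

Let V0 n : V n 0. Proof. by case: hB. Qed.
Let VD n a b : V n a -> V n b -> V n (a + b). Proof. by case: hB => _ h _ _ _; apply: h. Qed.
Let VZ n c a : V n a -> V n (c *: a). Proof. by case: hB => _ _ h _ _; apply: h. Qed.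
Let VM m n a b : V m a -> V n b -> V (m + n)%N (a * b).
Proof. by case: hB => _ _ _ h _; apply: h. Qed.
Let VC c : V 0%N (c%:A). Proof. by case: hB => _ _ _ _ [h _ _]; apply/h; exists c. Qed.
Let V0C b : V 0%N b -> exists c : k, b = c%:A.
Proof. by case: hB => _ _ _ _ [h _ _] /h. Qed.
Let Vsum n I (r : seq I) (P : pred I) F :
  (forall i, P i -> V n (F i)) -> V n (\sum_(i <- r | P i) F i).
Proof. by move=> h; elim/big_ind: _ => //; apply: VD. Qed.

(** The components of [b] are stored as coefficients in an auxiliary variable, and evaluation at 1
    adds them up. Thus [decomp] is an injective ring homomorphism to polynomials, and the lemmas on
    polynomials apply to gradings. *)
Definition is_decomp (b : B) (G : {poly B}) := (forall n, V n G`_n) /\ G.[1] = b.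

Lemma decomp_ex b : exists G, is_decomp b G.
Proof.
case: hB => _ _ _ _ [_ h _]; have [N [bs [Vbs ->]]] := h b.
exists (\sum_(i < N) (bs i)%:P * 'X^i); split.
  move=> n; rewrite coef_sum; apply: Vsum => i _; rewrite coefCM coefXn.
  by case: eqP => [->|_]; rewrite ?mulr1 ?mulr0.
rewrite horner_sum; apply: eq_bigr => i _.
by rewrite hornerCM hornerXn expr1n mulr1.
Qed.

Lemma decomp_uniq b G G' : is_decomp b G -> is_decomp b G' -> G = G'.
Proof.
move=> [VG Gb] [VG' Gb']; apply/eqP; rewrite -subr_eq0; apply/eqP.
have VGG n : V n (G - G')`_n.
  by rewrite coefB -scaleN1r; apply: VD => //; apply: VZ.
have : (G - G').[1] = 0 by rewrite hornerD hornerN Gb Gb' subrr.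
rewrite horner_coef => h.
case: hB => _ _ _ _ [_ _ u].
have {}u := u _ (fun i : 'I_(size (G - G')) => (G - G')`_i) (fun i => VGG i).
apply/polyP => i; rewrite coef0.
have [i1|i2] := ltnP i (size (G - G')); last by rewrite nth_default.
apply: (u _ (Ordinal i1)); rewrite -[RHS]h; apply: eq_bigr => j _.
by rewrite expr1n mulr1.
Qed.

Definition decomp b : {poly B} := proj1_sig (constructive_indefinite_description _ (decomp_ex b)).

Lemma decompP b : is_decomp b (decomp b).
Proof. exact: proj2_sig. Qed.

Lemma decompE b G : is_decomp b G -> decomp b = G.
Proof. exact/decomp_uniq/decompP. Qed.

Lemma decomp_hom n b : V n b -> decomp b = b%:P * 'X^n.
Proof.
move=> Vb; apply: decompE; split; last by rewrite hornerCM hornerXn expr1n mulr1.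
by move=> m; rewrite coefCM coefXn; case: eqP => [->|_]; rewrite ?mulr1 ?mulr0.
Qed.

Lemma decompD a b : decomp (a + b) = decomp a + decomp b.
Proof.
apply: decompE; have [Va ea] := decompP a; have [Vb eb] := decompP b; split.
  by move=> n; rewrite coefD; apply: VD.
by rewrite hornerD ea eb.
Qed.

Lemma decompM a b : decomp (a * b) = decomp a * decomp b.
Proof.
apply: decompE; have [Va ea] := decompP a; have [Vb eb] := decompP b; split.
  move=> n; rewrite coefM; apply: Vsum => i _.
  by rewrite -{1}(subnKC (leq_ord i)); apply: VM.
by rewrite hornerM_comm ?ea ?eb // /comm_poly mul1r mulr1.
Qed.

Lemma decompA c : decomp c%:A = (c%:A)%:P.
Proof. by rewrite (decomp_hom (VC c)) expr0 mulr1. Qed.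

Lemma decomp0 : decomp 0 = 0.
Proof. by rewrite (decomp_hom (V0 0)) mul0r. Qed.

Lemma decomp1 : decomp 1 = 1.
Proof. by have := decompA 1; rewrite scale1r. Qed.

Lemma decompZ c a : decomp (c *: a) = (c%:A)%:P * decomp a.
Proof. by rewrite -decompA -decompM mulr_algl. Qed.

Lemma decomp_comp b n : decomp (decomp b)`_n = ((decomp b)`_n)%:P * 'X^n.
Proof. by apply: decomp_hom; case: (decompP b). Qed.

Lemma decomp_sum b : b = \sum_(n < size (decomp b)) (decomp b)`_n.
Proof.
have [_ {1}<-] := decompP b; rewrite horner_coef; apply: eq_bigr => i _.
by rewrite expr1n mulr1.
Qed.

Lemma decomp_coef0 b : exists c : k, (decomp b)`_0 = c%:A.
Proof. by apply: V0C; case: (decompP b). Qed.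

Hypothesis iB : integral_ring B.

(** Under [decomp] a homogeneous element becomes a monomial, so by [monomial_conj] conjugation by
    [x] preserves its degree. Hence [decomp x] conjugates constants to constants, as [normal_coef]
    requires. *)
Lemma normal_decomp x y y' : normal_elt x -> x * y = y' * x ->
  forall d e, (decomp x)`_d * (decomp y)`_e = (decomp y')`_e * (decomp x)`_d.
Proof.
move=> nx xy; apply: (normal_coef iB); last by rewrite -!decompM xy.
move=> z; case: (eqVneq x 0) => [->|x0].
  by exists 0; rewrite decomp0 mul0r mulr0.
have dx0 : decomp x != 0.
  apply: contraNneq x0 => dx0; have [_ <-] := decompP x.
  by rewrite dx0 horner0.
rewrite (decomp_sum z); elim/big_ind: _ => [|a b [g Hg] [g' Hg']|n _].
- by exists 0; rewrite mulr0 mul0r.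
- by exists (g + g'); rewrite !polyCD mulrDr mulrDl Hg Hg'.
have [w xw] := nx (decomp z)`_n.
have := congr1 decomp xw; rewrite !decompM decomp_comp.
by case/(monomial_conj iB dx0) => g [_ ->]; exists g.
Qed.

Definition bicomp d e (s : {poly B}) : B := (decomp s`_e)`_d.

(** Two passes: [normal_coef] separates the degrees in t, then [normal_decomp] separates the degrees
    of [B]. *)
Lemma bicomp_normal (X Y H : {poly B}) : normal_elt X -> X * Y = H * X ->
  forall d e d' e', bicomp d e X * bicomp d' e' Y = bicomp d' e' H * bicomp d e X.
Proof.
move=> nX XY d e d' e'; have nC := normal_polyC iB nX.
rewrite /bicomp; apply: normal_decomp; last exact: (normal_coef iB).
(* Each coefficient of [X] is normal in [B], since [X] conjugates constants to constants. *)
move=> y; have [g Xg] := nC y; exists g.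
by have := congr1 (fun P : {poly B} => P`_e) Xg; rewrite coefMC coefCM.
Qed.

End Grading.

(** * Adjoining a central variable *)

(* {poly B} as a k-algebra: MathComp only provides the B-module structure. *)
Definition apoly (k : fieldType) (B : algType k) : Type := {poly B}.

Section PolyAlgebra.
Variables (k : fieldType) (B : algType k).

Definition apoly_scale (c : k) (P : {poly B}) : {poly B} := (c%:A)%:P * P.

Lemma apoly_scaleA a b P : apoly_scale a (apoly_scale b P) = apoly_scale (a * b) P.
Proof. by rewrite /apoly_scale mulrA -polyCM mulr_algl scalerA. Qed.

Lemma apoly_scale1 : left_id 1 apoly_scale.
Proof. by move=> P; rewrite /apoly_scale scale1r mul1r. Qed.

Lemma apoly_scaleDr : right_distributive apoly_scale +%R.
Proof. by move=> c P Q; rewrite /apoly_scale mulrDr. Qed.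

Lemma apoly_scaleDl P : {morph apoly_scale^~ P : a b / a + b}.
Proof. by move=> a b; rewrite /apoly_scale scalerDl polyCD mulrDl. Qed.

HB.instance Definition _ := GRing.NzRing.on (apoly B).
HB.instance Definition _ := GRing.Zmodule_isLmodule.Build k (apoly B)
  apoly_scaleA apoly_scale1 apoly_scaleDr apoly_scaleDl.

Lemma apoly_scalerAl c (P Q : apoly B) : c *: (P * Q) = (c *: P : apoly B) * Q.
Proof. exact: mulrA. Qed.

HB.instance Definition _ := GRing.Lmodule_isLalgebra.Build k (apoly B) apoly_scalerAl.

Lemma apoly_scalerAr c (P Q : apoly B) : c *: (P * Q) = P * (c *: Q : apoly B).
Proof.
suff h : (c%:A)%:P * P = P * (c%:A)%:P :> {poly B}.
  by rewrite /GRing.scale /= /apoly_scale mulrA h mulrA.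
by apply/polyP => i; rewrite coefCM coefMC mulr_algl mulr_algr.
Qed.

HB.instance Definition _ := GRing.Lalgebra_isAlgebra.Build k (apoly B) apoly_scalerAr.

Lemma apolyZE c (P : apoly B) : c *: P = (c%:A)%:P * P :> {poly B}.
Proof. by []. Qed.

Lemma coef_apolyZ c (P : apoly B) i : (c *: P : {poly B})`_i = c *: P`_i.
Proof. by rewrite apolyZE coefCM mulr_algl. Qed.

Lemma polyC_hom : alg_hom (polyC : B -> apoly B).
Proof.
split=> [a b|a b||c a]; rewrite ?polyCD ?polyCM //.
by rewrite apolyZE -polyCM mulr_algl.
Qed.

Lemma coef0_hom : alg_hom ((fun P : {poly B} => P`_0) : apoly B -> B).
Proof.
split=> [P Q|P Q||c P]; rewrite ?coefD ?coef0M ?coefC ?eqxx //.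
by rewrite mulr_algl.
Qed.

End PolyAlgebra.

Section AddCentralVariable.
Variables (k : fieldType) (n : nat) (p : 'I_n -> 'I_n -> k).

Definition ext_params (i j : 'I_n.+1) : k :=
  if unlift ord_max i is Some a then
    if unlift ord_max j is Some b then p a b else 1
  else 1.

Definition ext_gens (A : algType k) (x : 'I_n -> A) (i : 'I_n.+1) : apoly A :=
  if unlift ord_max i is Some a then (x a)%:P else 'X.

Lemma ext_params_lift a b : ext_params (lift ord_max a) (lift ord_max b) = p a b.
Proof. by rewrite /ext_params !liftK. Qed.

Lemma ext_params_maxl j : ext_params ord_max j = 1.
Proof. by rewrite /ext_params unlift_none. Qed.

Lemma ext_params_maxr i : ext_params i ord_max = 1.
Proof. by rewrite /ext_params unlift_none; case: unliftP. Qed.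

Lemma ext_params_q : q_params p -> q_params ext_params.
Proof.
case=> p1 pV; split=> [i|i j].
  by case: (unliftP ord_max i) => [a|] ->; rewrite ?ext_params_lift ?ext_params_maxl.
case: (unliftP ord_max i) => [a|] ->; last by rewrite ext_params_maxl ext_params_maxr mulr1.
case: (unliftP ord_max j) => [b|] ->; last by rewrite ext_params_maxl ext_params_maxr mulr1.
by rewrite !ext_params_lift.
Qed.

Lemma ext_gens_lift (A : algType k) (x : 'I_n -> A) a :
  ext_gens x (lift ord_max a) = (x a)%:P.
Proof. by rewrite /ext_gens liftK. Qed.

Lemma ext_gens_max (A : algType k) (x : 'I_n -> A) : ext_gens x ord_max = 'X.
Proof. by rewrite /ext_gens unlift_none. Qed.

Lemma ext_gens_rel (A : algType k) (x : 'I_n -> A) : q_rel p x ->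
  q_rel ext_params (ext_gens x).
Proof.
move=> hx i j.
case: (unliftP ord_max i) => [a|] ->; last first.
  by rewrite ext_params_maxl scale1r ext_gens_max commr_polyX.
case: (unliftP ord_max j) => [b|] ->; last first.
  by rewrite ext_params_maxr scale1r ext_gens_max commr_polyX.
rewrite ext_params_lift !ext_gens_lift.
by rewrite -!(alg_homM (polyC_hom A)) hx (alg_homZ (polyC_hom A)).
Qed.

End AddCentralVariable.

(** The universal property of a central polynomial variable: map the coefficients by [f], then
    evaluate at [t], which is multiplicative because [t] is central. *)
Lemma alg_hom_horner (k : fieldType) (A C : algType k) (f : A -> C) (t : C) :
  alg_hom f -> (forall c, t * c = c * t) ->
  exists F : apoly A -> C, [/\ alg_hom F, forall a, F a%:P = f a & F 'X = t].
Proof.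
move=> hf tC.
have [f' Ef] : exists f' : {rmorphism A -> C}, f' =1 f.
  pose f' : {rmorphism A -> C} := HB.pack f
    (GRing.isZmodMorphism.Build A C f (alg_homB hf))
    (GRing.isMonoidMorphism.Build A C f (alg_hom1 hf, alg_homM hf)).
  by exists f'.
have hC (Q : {poly C}) : comm_poly Q t by exact: tC.
exists (fun P => (map_poly f' P).[t]); split.
- split=> [P Q|P Q||c P].
  + by rewrite rmorphD hornerD.
  + by rewrite rmorphM hornerM_comm.
  + by rewrite rmorph1 hornerC.
  + by rewrite apolyZE rmorphM /= map_polyC hornerCM /= Ef (alg_homZ hf) (alg_hom1 hf) mulr_algl.
- by move=> a; rewrite map_polyC hornerC /= Ef.
- by rewrite map_polyX hornerX.
Qed.

Lemma apoly_hom_eq (k : fieldType) (A C : algType k) (F G : apoly A -> C) :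
  alg_hom F -> alg_hom G -> (forall a, F a%:P = G a%:P) -> F 'X = G 'X -> F =1 G.
Proof.
move=> hF hG eC eX; elim/poly_ind => [|P a IH].
  by rewrite (alg_hom0 hF) (alg_hom0 hG).
by rewrite (alg_homD hF) (alg_homD hG) (alg_homM hF) (alg_homM hG) IH eC eX.
Qed.

(** Universal properties give maps in both directions, and both composites fix the generators. *)
Lemma skew_poly_ext (k : fieldType) (p : 'I_3 -> 'I_3 -> k) (A : algType k)
    (x : 'I_3 -> A) : skew_params p -> is_skew_poly_ring p x ->
  exists F : skewpoly (ext_params p) -> apoly A,
    [/\ alg_hom F, bijective F & forall i, F (skew_gen _ i) = ext_gens x i].
Proof.
move=> hp [xrel univ].
have hp4 : q_params (ext_params p) by exact: ext_params_q.
pose e := skew_gen (ext_params p).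
have erel := skew_gen_rel hp4.
have grel : q_rel (ext_params p) (ext_gens x) by exact: ext_gens_rel.
have [F hF Fe] : exists2 F : skewpoly (ext_params p) -> apoly A,
    alg_hom F & forall i, F (e i) = ext_gens x i.
  exists (skew_eval (ext_gens x)); first exact: skew_eval_hom.
  exact: skew_eval_gen.
exists F; split => //.
have [f [hf fx]] : exists f : A -> skewpoly (ext_params p),
    alg_hom f /\ forall i, f (x i) = e (lift ord_max i).
  by apply: (univ _ _ _).1 => i j; rewrite erel ext_params_lift.
have tC c : e ord_max * c = c * e ord_max.
  move: c; apply: (skew_ind hp4) => [|a c d Hc Hd|i c Hc].
  - exact: commr1.
  - by rewrite mulrDr mulrDl -scalerAr Hc Hd scalerAl.
  - apply: commrM => //; have := erel i ord_max.
    by rewrite ext_params_maxr scale1r.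
have [G [hG Gf GX]] := alg_hom_horner hf tC.
exists G => [c|P].
  apply: (skew_hom_eq hp4 (f := G \o F) (g := id)) c => [|//|i /=].
    exact: alg_hom_comp.
  rewrite Fe; case: (unliftP ord_max i) => [a|] ->.
    by rewrite ext_gens_lift Gf fx.
  by rewrite ext_gens_max GX.
apply: (apoly_hom_eq (F := F \o G) (G := id)) P => [|//|a /=|/=].
- exact: alg_hom_comp.
- rewrite Gf; have := (univ (apoly A) (fun i => (x i)%:P) _).2 (F \o f) (@polyC A).
  apply.
  + by move=> i j; rewrite -!(alg_homM (polyC_hom A)) xrel (alg_homZ (polyC_hom A)).
  + exact: alg_hom_comp.
  + exact: polyC_hom.
  + by move=> i /=; rewrite fx Fe ext_gens_lift.
- by rewrite GX Fe ext_gens_max.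
Qed.

(** * Bihomogeneous components *)

Section Bicomponents.
Variables (k : fieldType) (B : algType k) (V : nat -> B -> Prop).
Hypothesis hB : connected_graded V.
Local Notation bc := (bicomp hB).

Definition bimono d e (s : {poly B}) : {poly B} := (bc d e s)%:P * 'X^e.

Lemma bicompD d e s t : bc d e (s + t) = bc d e s + bc d e t.
Proof. by rewrite /bicomp coefD decompD coefD. Qed.

Lemma bicompZ d e c (s : apoly B) : bc d e (c *: s) = c *: bc d e s.
Proof. by rewrite /bicomp coef_apolyZ decompZ coefCM mulr_algl. Qed.

Lemma bicomp0 d e : bc d e 0 = 0.
Proof. by rewrite /bicomp coef0 decomp0 coef0. Qed.

Lemma bicompM d e s t : bc d e (s * t) =
  \sum_(i < e.+1) \sum_(l < d.+1) bc l i s * bc (d - l) (e - i) t.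
Proof.
rewrite /bicomp coefM (big_morph (decomp hB) (decompD hB) (decomp0 hB)) coef_sum.
by apply: eq_bigr => i _; rewrite decompM coefM.
Qed.

Lemma bicomp_mono d e d' e' s :
  bc d e (bimono d' e' s) = if (d == d') && (e == e') then bc d e s else 0.
Proof.
rewrite /bicomp coefCM coefXn; case: (e =P e') => [->|_]; last first.
  by rewrite mulr0 decomp0 coef0 andbF.
rewrite mulr1 andbT decomp_comp coefCM coefXn.
by case: eqP => [->|_]; rewrite ?mulr1 ?mulr0.
Qed.

Lemma bimonoD d e s t : bimono d e (s + t) = bimono d e s + bimono d e t.
Proof. by rewrite /bimono bicompD polyCD mulrDl. Qed.

Lemma bimono0 d e : bimono d e 0 = 0.
Proof. by rewrite /bimono bicomp0 mul0r. Qed.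

Lemma bimonoZ d e c (s : apoly B) :
  bimono d e (c *: s) = (c *: (bimono d e s : apoly B) : apoly B).
Proof. by rewrite /bimono bicompZ apolyZE mulrA -polyCM mulr_algl. Qed.

Lemma bimono_sum d e I (r : seq I) (P : pred I) F :
  bimono d e (\sum_(i <- r | P i) F i) = \sum_(i <- r | P i) bimono d e (F i).
Proof. exact: (big_morph _ (bimonoD d e) (bimono0 d e)). Qed.

Lemma monoM (x y : B) e e' :
  (x%:P * 'X^e) * (y%:P * 'X^e') = (x * y)%:P * 'X^(e + e') :> {poly B}.
Proof. by rewrite polyCM exprD !mulrA -[x%:P * 'X^e * y%:P]mulrA -commr_polyXn !mulrA. Qed.

Lemma bimonoM d e s t : bimono d e (s * t) =
  \sum_(i < e.+1) \sum_(l < d.+1) bimono l i s * bimono (d - l) (e - i) t.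
Proof.
rewrite /bimono bicompM (raddf_sum (@polyC B)) mulr_suml; apply: eq_bigr => i _.
rewrite (raddf_sum (@polyC B)) mulr_suml; apply: eq_bigr => l _.
by rewrite monoM subnKC ?leq_ord.
Qed.

Lemma bimono_mono d e d' e' s :
  bimono d e (bimono d' e' s) = if (d == d') && (e == e') then bimono d e s else 0.
Proof. by rewrite {1}/bimono bicomp_mono; case: ifP => // _; rewrite mul0r. Qed.

(** The expansion holds for all large [M], so that several elements can be expanded over a common
    index set. *)
Lemma bimono_expand s : exists N, forall M, (N <= M)%N ->
  s = \sum_(c : 'I_M * 'I_M) bimono c.1 c.2 s.
Proof.
exists (maxn (size s) (\max_(e < size s) size (decomp hB s`_e))) => M.
rewrite geq_max => /andP[sM /bigmax_leqP dM].
rewrite (eq_bigl (fun c => true && true)) // -(pair_big xpredT xpredT (fun d e : 'I_M => bimono d e s)) /=.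
rewrite exchange_big /= -[LHS]coefK poly_def (big_ord_widen _ (fun i => s`_i *: 'X^i) sM) big_mkcond.
apply: eq_bigr => e _; rewrite -mul_polyC -mulr_suml -(raddf_sum (@polyC B)) /bicomp.
case: ltnP => es.
  rewrite {1}(decomp_sum hB s`_e).
  have le := dM (Ordinal es) isT.
  rewrite (big_ord_widen _ (fun n => (decomp hB s`_e)`_n) le) big_mkcond.
  congr (_%:P * _); apply: eq_bigr => i _; case: ltnP => // h.
  by rewrite nth_default.
by rewrite (nth_default _ es) decomp0 big1 ?mul0r // => i _; rewrite coef0.
Qed.

Lemma bicomp_eq0 s : (forall d e, bc d e s = 0) -> s = 0.
Proof.
move=> h; have [N /(_ N (leqnn N)) ->] := bimono_expand s.
by rewrite big1 // => c _; rewrite /bimono h mul0r.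
Qed.

Lemma bimono00M s t : bimono 0 0 (s * t) = bimono 0 0 s * bimono 0 0 t.
Proof. by rewrite bimonoM !big_ord1. Qed.

Lemma bimono_const d e (c : k) :
  bimono d e (c%:A)%:P = if (d == 0%N) && (e == 0%N) then (c%:A)%:P else 0.
Proof.
rewrite /bimono /bicomp coefC; case: (e =P 0%N) => [->|_]; last first.
  by rewrite /= decomp0 coef0 mul0r andbF.
by rewrite /= decompA coefC expr0 mulr1 andbT; case: eqP.
Qed.

Lemma bimono00_mono d m m' s : (d != 0%N) || (m != 0%N) ->
  bimono 0 0 ((bc d m' s)%:P * 'X^m) = 0.
Proof.
rewrite /bimono /bicomp coefCM coefXn; case: m => [|m] /=; last first.
  by rewrite mulr0 decomp0 coef0 mul0r.
rewrite orbF !mulr1 decomp_comp coefCM coefXn eq_sym => /negPf->.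
by rewrite mulr0.
Qed.

Lemma bimonoX01 : bimono 0 1 'X = 'X.
Proof. by rewrite /bimono /bicomp coefX decomp1 coefC expr1 mul1r. Qed.

End Bicomponents.

(** Multilinearity in the rows: [f] records from which summand each row is taken. *)
Lemma det_sum_rows (R : comNzRingType) (J : finType) n (A : J -> 'M[R]_n) :
  \det (\sum_c A c) = \sum_(f : {ffun 'I_n -> J}) \det (\matrix_(i, j) A (f i) i j).
Proof.
rewrite /determinant exchange_big; apply: eq_bigr => s _ /=.
rewrite -mulr_sumr; congr (_ * _).
under eq_bigr => i _ do rewrite summxE.
rewrite (bigA_distr_bigA (fun i c => A c i ((s : 'S_n) i))).
by apply: eq_bigr => f _; apply: eq_bigr => i _; rewrite mxE.
Qed.

Lemma bij_choice (T : choiceType) (U : eqType) (f : T -> U) :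
  injective f -> (forall y, exists x, f x = y) -> bijective f.
Proof.
move=> fI fS; have fS' y : exists x, f x == y by have [x <-] := fS y; exists x.
pose g y := xchoose (fS' y).
have gK : cancel g f by move=> y; apply/eqP; exact: (xchooseP (fS' y)).
by exists g => // x; apply: fI; rewrite gK.
Qed.

Lemma alg_hom_inv (k : fieldType) (A C : algType k) (f : A -> C) (g : C -> A) :
  alg_hom f -> cancel f g -> cancel g f -> alg_hom g.
Proof.
move=> hf fK gK; split=> [a b|a b||c a]; apply: (can_inj fK).
- by rewrite (alg_homD hf) !gK.
- by rewrite (alg_homM hf) !gK.
- by rewrite (alg_hom1 hf) gK.
- by rewrite (alg_homZ hf) !gK.
Qed.

(** If [q i j] is 1, the two elements commute and scalars may be subtracted. Otherwise both shifts
    vanish, the second because [q j i] is inverse to [q i j]. *)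
Lemma q_rel_shift (k : fieldType) n (q : 'I_n -> 'I_n -> k) (C : algType k)
    (y : 'I_n -> C) (a : 'I_n -> k) : q_params q -> q_rel q y ->
  (forall i j, a i != 0 -> q i j = 1) -> q_rel q (fun i => y i - (a i)%:A).
Proof.
move=> hq hy ha i j; have [_ qV] := hq.
have [qij|qij] := eqVneq (q i j) 1; first rewrite qij.
  have cA (c : k) (z : C) : GRing.comm z c%:A by rewrite /GRing.comm mulr_algl mulr_algr.
  rewrite scale1r; apply: commrB; last exact: cA.
  apply: commr_sym; apply: commrB; last exact: cA.
  by rewrite /GRing.comm (hy i j) qij scale1r.
have ai : a i = 0 by apply: contraNeq qij => /ha->.
have aj : a j = 0.
  by apply: contraNeq qij => /ha e; have := qV i j; rewrite e mulr1 => ->.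
by rewrite ai aj scale0r !subr0 hy.
Qed.

(** * Components of the images of the generators *)

Section Isomorphism.
Variables (k : fieldType) (B : algType k) (V : nat -> B -> Prop).
Hypothesis hB : connected_graded V.
Variables (n : nat) (q : 'I_n -> 'I_n -> k).
Hypothesis hq : q_params q.
Local Notation bc := (bicomp hB).
Local Notation bm := (bimono hB).
Local Notation R := (skewpoly q).
Local Notation e := (skew_gen q).

Variables (phi : R -> apoly B) (psi : apoly B -> R).
Hypotheses (hphi : alg_hom phi) (phiK : cancel phi psi) (psiK : cancel psi phi).

Let hpsi : alg_hom psi. Proof. exact: alg_hom_inv phiK psiK. Qed.

Lemma phi_eq0 r : phi r = 0 -> r = 0.
Proof. by rewrite -(alg_hom0 hphi) => /(can_inj phiK). Qed.

Lemma psi_eq0 s : psi s = 0 -> s = 0.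
Proof. by rewrite -(alg_hom0 hpsi) => /(can_inj psiK). Qed.

Lemma integral_apoly : integral_ring {poly B}.
Proof.
move=> s t st.
have /(skew_integral hq) : psi s * psi t = 0.
  by rewrite -(alg_homM hpsi) -(alg_hom0 hpsi); congr psi.
by case=> /psi_eq0->; [left | right].
Qed.

Lemma integral_base : integral_ring B.
Proof.
move=> a b ab; have /integral_apoly : a%:P * b%:P = 0 :> {poly B}.
  by rewrite -polyCM ab.
by case=> /eqP; rewrite polyC_eq0 => /eqP->; [left | right].
Qed.

Lemma phi_gen_neq0 i : phi (e i) != 0.
Proof.
apply/eqP => /phi_eq0 h; have := scoef_gen q U_(i)%MM i.
by rewrite h scoef0 eqxx => /esym/eqP; rewrite oner_eq0.
Qed.

Lemma phi_gen_normal i : @normal_elt {poly B} (phi (e i)).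
Proof.
move=> s; have [g eg] := skew_gen_normal hq i (psi s).
by exists (phi g); have := congr1 phi eg; rewrite !(alg_homM hphi) psiK.
Qed.

(* Conjugation by a normal element of a graded domain preserves degrees, so
   a quasi-commutation of normal elements passes to all their components. *)
Lemma bicomp_rel i j d d' m m' :
  bc d' m' (phi (e j)) * bc d m (phi (e i)) =
    q i j *: (bc d m (phi (e i)) * bc d' m' (phi (e j))).
Proof.
have rel : phi (e j) * phi (e i) = (q i j *: phi (e i)) * phi (e j) :> apoly B.
  by rewrite -(alg_homM hphi) (skew_gen_rel hq) (alg_homZ hphi) (alg_homM hphi) scalerAl.
rewrite (bicomp_normal hB integral_base (@phi_gen_normal j) rel).
by rewrite bicompZ scalerAl.
Qed.

(** The constant term is a nonzero scalar c. By [bicomp_rel], c(1 - [q i j]) kills every component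
    of [phi (e j)], which is nonzero. *)
Lemma bicomp00_central i : bc 0 0 (phi (e i)) != 0 -> forall j, q i j = 1.
Proof.
move=> ai j; apply/eqP; apply: contraNT (phi_gen_neq0 j) => qij.
apply/eqP/(bicomp_eq0 (hB := hB)) => d m.
have := bicomp_rel i j 0 d 0 m; have [c ec] := decomp_coef0 hB (phi (e i) : {poly B})`_0.
rewrite /bicomp ec in ai *.
have c0 : c != 0 by apply: contraNneq ai => ->; rewrite scale0r.
rewrite mulr_algl mulr_algr => /eqP; rewrite scalerA -subr_eq0 -scalerBl scaler_eq0.
rewrite -{1}[c]mul1r -mulrBl mulf_eq0 (negPf c0) orbF subr_eq0 eq_sym (negPf qij).
by move=> /eqP.
Qed.

End Isomorphism.

Lemma skew_shift_bij (k : fieldType) n (q : 'I_n -> 'I_n -> k) (a : 'I_n -> k) :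
  q_params q -> (forall i j, a i != 0 -> q i j = 1) ->
  exists F G : skewpoly q -> skewpoly q, [/\ alg_hom F, cancel F G, cancel G F &
    forall i, F (skew_gen q i) = skew_gen q i - (a i)%:A].
Proof.
move=> hq ha; have er := skew_gen_rel hq.
have ha' i j : - a i != 0 -> q i j = 1 by rewrite oppr_eq0; apply: ha.
have rF := q_rel_shift hq er ha; have rG := q_rel_shift hq er ha'.
have hF := skew_eval_hom hq rF; have hG := skew_eval_hom hq rG.
exists (skew_eval (fun i => skew_gen q i - (a i)%:A)).
exists (skew_eval (fun i => skew_gen q i - (- a i)%:A)).
split=> // [r|r|i]; last exact: skew_eval_gen.
- apply: (skew_hom_eq hq (g := id) (alg_hom_comp hF hG)) => [//|i /=].
  rewrite skew_eval_gen // (alg_homB hG) (alg_homZ hG) (alg_hom1 hG) skew_eval_gen //.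
  by rewrite scaleNr opprK addrK.
- apply: (skew_hom_eq hq (g := id) (alg_hom_comp hG hF)) => [//|i /=].
  rewrite skew_eval_gen // (alg_homB hF) (alg_homZ hF) (alg_hom1 hF) skew_eval_gen //.
  by rewrite scaleNr opprK subrK.
Qed.

(** Connectedness makes the constant terms scalars. By [bicomp00_central] a variable with a nonzero
    one has trivial parameters, so translation by the constant terms is an automorphism. *)
Lemma augmented_iso (k : fieldType) (B : algType k) (V : nat -> B -> Prop)
    (hB : connected_graded V) n (q : 'I_n -> 'I_n -> k) (phi : skewpoly q -> apoly B) :
  q_params q -> alg_hom phi -> bijective phi ->
  exists (F : skewpoly q -> apoly B) G, [/\ alg_hom F, cancel F G, cancel G F &
    forall i, bimono hB 0 0 (F (skew_gen q i)) = 0].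
Proof.
move=> hq hphi [psi phiK psiK].
have [a ea] := fin_all_exists (fun i => decomp_coef0 hB (phi (skew_gen q i) : {poly B})`_0).
have {}ea i : bicomp hB 0 0 (phi (skew_gen q i)) = (a i)%:A := ea i.
have [|F [G [hF FK GK Fe]]] := @skew_shift_bij _ _ q a hq.
  move=> i j ai; apply: (bicomp00_central (hB := hB) hq hphi phiK psiK).
  by rewrite ea scaler_eq0 oner_eq0 orbF; exact: ai.
exists (phi \o F), (G \o psi); split.
- exact: alg_hom_comp.
- exact: can_comp.
- exact: can_comp.
move=> i; rewrite /= Fe (alg_homB hphi) (alg_homZ hphi) (alg_hom1 hphi).
rewrite -scaleNr bimonoD bimonoZ.
have -> : bimono hB 0 0 (phi (skew_gen q i)) = ((a i)%:A)%:P.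
  by rewrite /bimono ea expr0 mulr1.
have := bimono_const hB 0 0 1; rewrite scale1r eqxx /= => ->.
by rewrite apolyZE mulr1 -polyCD -scalerDl subrr scale0r.
Qed.

(** * Homogeneous generators *)

(** A monomial of degree at least 2 is, up to a scalar, a generator times a monomial of positive
    degree. *)
Lemma sord2_ind (k : fieldType) n (q : 'I_n -> 'I_n -> k) (P : skewpoly q -> Prop) :
  q_params q -> P 0 -> (forall c f g, P f -> P g -> P (c *: f + g)) ->
  (forall i f, sord 1 f -> P (skew_gen q i * f)) -> forall w, sord 2 w -> P w.
Proof.
move=> hq P0 Pl PM w hw; rewrite [w]skew_expand.
elim: (msupp w) => [|u l IH]; first by rewrite big_nil.
rewrite big_cons; have [u2|] := ltnP (mdeg u) 2.
  by rewrite hw // scale0r add0r.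
move=> u2; apply: (Pl) => //; move: u2.
elim/mnm_ind: u => [|i u _]; first by rewrite mdeg0.
rewrite mdegD mdeg1 add1n ltnS => u1.
rewrite skewX_split // -[_ *: _]addr0; apply: (Pl) => //; apply: (PM) => v v1.
by rewrite scoefX; case: eqP => // e; rewrite -e ltnNge u1 in v1.
Qed.

Section Augmented.
Variables (k : fieldType) (B : algType k) (V : nat -> B -> Prop).
Hypothesis hB : connected_graded V.
Variables (n : nat) (q : 'I_n -> 'I_n -> k).
Hypothesis hq : q_params q.
Local Notation bc := (bicomp hB).
Local Notation bm := (bimono hB).
Local Notation R := (skewpoly q).
Local Notation e := (skew_gen q).

Variables (phi : R -> apoly B) (psi : apoly B -> R).
Hypotheses (hphi : alg_hom phi) (phiK : cancel phi psi) (psiK : cancel psi phi).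
Hypothesis z0 : forall i, bm 0 0 (phi (e i)) = 0.

Let hpsi : alg_hom psi. Proof. exact: alg_hom_inv phiK psiK. Qed.

(** Both sides are multiplicative and linear in [r] and kill the generators; so [phi] respects the
    augmentations. *)
Lemma bimono00_phi r : bm 0 0 (phi r) = ((scoef 0%MM r)%:A)%:P.
Proof.
move: r; apply: (skew_ind hq) => [|c r s Hr Hs|i r Hr].
- rewrite (alg_hom1 hphi) scoef1 eqxx.
  by have := bimono_const hB 0 0 1; rewrite scale1r eqxx /= => ->.
- rewrite (alg_homD hphi) (alg_homZ hphi) bimonoD bimonoZ Hr Hs scoefP apolyZE.
  by rewrite -polyCM -polyCD mulr_algl scalerA scalerDl.
rewrite (alg_homM hphi) bimono00M z0 mul0r.
have h : sord (1 + 0) (e i * r) by apply: sordM => //; apply: sord_gen.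
by rewrite h ?mdeg0 // scale0r.
Qed.

Lemma sord1_psi s : bm 0 0 s = 0 -> sord 1 (psi s).
Proof.
move=> zs; apply: sord1; have := bimono00_phi (psi s).
rewrite psiK zs => /esym/eqP; rewrite polyC_eq0 scaler_eq0 oner_eq0 orbF.
by move/eqP.
Qed.

(** The linear parts of all components of [phi (e j)] add up to row [j] of the identity matrix,
    because [psi] inverts [phi]. Its determinant expands into a sum over choices of components, so
    some choice has a nonzero term. *)
Lemma nonsingular_components : exists f : 'I_n -> nat * nat,
  \det (\matrix_(j, i) scoef U_(i)%MM (psi (bm (f j).1 (f j).2 (phi (e j))))) != 0.
Proof.
have [N HN] := fin_all_exists (fun j => bimono_expand hB (phi (e j))).
pose M := (\max_j N j)%N.
have HM j : phi (e j) = \sum_(c : 'I_M * 'I_M) bm c.1 c.2 (phi (e j)).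
  by apply: HN; apply: leq_bigmax.
pose A (c : 'I_M * 'I_M) : 'M[k]_n :=
  \matrix_(j, i) scoef U_(i)%MM (psi (bm c.1 c.2 (phi (e j)))).
have sA : \sum_c A c = 1%:M.
  apply/matrixP => j i; rewrite summxE !mxE.
  transitivity (scoef U_(i)%MM (psi (phi (e j)))).
    rewrite [in RHS]HM (alg_hom_sum hpsi) scoef_sum.
    by apply: eq_bigr => c _; rewrite mxE.
  by rewrite phiK scoef_gen eq_mnm1.
have : \det (\sum_c A c) != 0 by rewrite sA det1 oner_neq0.
rewrite det_sum_rows => nz.
have [F HF] : exists F : {ffun 'I_n -> 'I_M * 'I_M},
    \det (\matrix_(i, j) A (F i) i j) != 0.
  apply/existsP; apply: contraNT nz => /existsPn h.
  by rewrite big1 // => F _; apply/eqP; have := h F; rewrite negbK.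
exists (fun j => (val (F j).1, val (F j).2)); apply: contraNneq HF => <-.
by apply/eqP; congr (\det _); apply/matrixP => i j; rewrite !mxE.
Qed.

Variable f : 'I_n -> nat * nat.
Let b (j : 'I_n) : apoly B := bm (f j).1 (f j).2 (phi (e j)).
(** Row [j] is the linear part of [psi (b j)]; invertibility says that these elements form a basis
    of the augmentation ideal modulo its square. *)
Let T : 'M[k]_n := \matrix_(j, i) scoef U_(i)%MM (psi (b j)).
Hypothesis hT : \det T != 0.

Lemma leading_z j : bm 0 0 (b j) = 0.
Proof. by rewrite /b bimono_mono z0; case: ifP. Qed.

Lemma leading_rel : q_rel q b.
Proof.
move=> i j; rewrite apolyZE /b /bimono !monoM.
rewrite (bicomp_rel hB hq hphi phiK psiK) mulrA -polyCM mulr_algl.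
by rewrite addnC.
Qed.

Lemma leading_split r : exists (c : 'I_n -> k) w,
  r = scoef 0%MM r *: 1 + \sum_j c j *: psi (b j) + w /\ sord 2 w.
Proof.
(* The coordinates of the linear part of [r] in the basis formed by the rows of [T]. *)
pose c : 'rV[k]_n := (\row_i scoef U_(i)%MM r) *m invmx T.
exists (fun j => c 0 j).
exists (r - (scoef 0%MM r *: 1 + \sum_j c 0 j *: psi (b j))); split.
  by rewrite addrC subrK.
move=> u; rewrite ltnS leq_eqVlt ltnS leqn0 mdeg_eq0 => /orP[/mdeg1P[i /eqP->]|/eqP->].
  rewrite scoefB scoefD scoefZ scoef1 eq_sym mnm1_eq0 mulr0 add0r scoef_sum.
  have : (c *m T) 0 i = scoef U_(i)%MM r.
    by rewrite mulmxKV ?unitmxE ?unitfE // mxE.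
  rewrite mxE => <-; apply/eqP; rewrite subr_eq0; apply/eqP.
  by apply: eq_bigr => j _; rewrite scoefZ [T _ _]mxE.
rewrite scoefB scoefD scoefZ scoef1 eqxx mulr1 scoef_sum big1 ?addr0 ?subrr // => j _.
by rewrite scoefZ (sord1_psi (leading_z j)) ?mdeg0 ?mulr0.
Qed.

Let g : R -> apoly B := skew_eval (p := q) b.
Let hg : alg_hom g. Proof. exact: (skew_eval_hom hq leading_rel). Qed.
Let ge j : g (e j) = b j. Proof. exact: (skew_eval_gen leading_rel j). Qed.

(** Induction on the total degree. After [leading_split], the constant and linear terms are visibly
    in the range, and the remainder of order 2 yields products of components of smaller total
    degree. *)
Lemma leading_range d m s : exists r, g r = bm d m s.
Proof.
have [N] := ubnP (d + m); elim: N d m s => // N IH d m s dmN.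
pose ran (t : apoly B) := exists r, g r = t.
have ranD t t' : ran t -> ran t' -> ran (t + t').
  by move=> [r <-] [r' <-]; exists (r + r'); rewrite (alg_homD hg).
have ranZ c t : ran t -> ran (c *: t).
  by move=> [r <-]; exists (c *: r); rewrite (alg_homZ hg).
have ranM t t' : ran t -> ran t' -> ran (t * t').
  by move=> [r <-] [r' <-]; exists (r * r'); rewrite (alg_homM hg).
have ran0 : ran 0 by exists 0; exact: alg_hom0 hg.
have ran_sum I (r : seq I) (P : pred I) (F : I -> apoly B) :
    (forall i, P i -> ran (F i)) -> ran (\sum_(i <- r | P i) F i).
  by move=> h; elim/big_ind: _.
suff main r : ran (bm d m (phi r)) by have := main (psi s); rewrite psiK.
have [c [w [{1}-> hw]]] := leading_split r.
rewrite !(alg_homD hphi) !bimonoD; apply: (ranD); first apply: (ranD).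
- rewrite (alg_homZ hphi) bimonoZ; apply: (ranZ); rewrite (alg_hom1 hphi).
  have := bimono_const hB d m 1; rewrite scale1r => ->.
  by case: ifP => // _; exists 1; exact: alg_hom1 hg.
- rewrite (alg_hom_sum hphi) bimono_sum; apply: (ran_sum) => j _.
  rewrite (alg_homZ hphi) bimonoZ psiK; apply: (ranZ).
  rewrite /b bimono_mono; case: ifP => [/andP[/eqP-> /eqP->]|//].
  by exists (e j); rewrite ge.
move: w hw {c}; apply: (sord2_ind hq) => [|c w w' Hw Hw'|i w hw].
- by rewrite (alg_hom0 hphi) bimono0.
- by rewrite (alg_homD hphi) (alg_homZ hphi) bimonoD bimonoZ; apply: (ranD); first apply: (ranZ).
rewrite (alg_homM hphi) bimonoM; apply: (ran_sum _ _ xpredT) => l _.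
apply: (ran_sum _ _ xpredT) => o _.
have zw : bm 0 0 (phi w) = 0 by rewrite bimono00_phi hw ?mdeg0 // scale0r.
have := ltn_ord l; have := ltn_ord o; rewrite !ltnS => od lm.
(* Both factors have zero constant component, so a nonvanishing term has positive total degree in
   each factor, hence less than [d + m] in both. *)
have [lo0|lo] := posnP (o + l).
  move/eqP: lo0; rewrite addn_eq0 => /andP[/eqP-> /eqP->].
  by rewrite z0 mul0r.
have [lo1|lo1] := eqVneq (o + l)%N (d + m)%N.
  have -> : (d - o = 0)%N by lia.
  have -> : (m - l = 0)%N by lia.
  by rewrite zw mulr0.
by apply: ranM; apply: IH; lia.
Qed.

Lemma leading_surj s : exists r, g r = s.
Proof.
have [N /(_ N (leqnn N)) ->] := bimono_expand hB s.
have [r Hr] := fin_all_exists (fun c : 'I_N * 'I_N => leading_range c.1 c.2 s).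
by exists (\sum_c r c); rewrite (alg_hom_sum hg); apply: eq_bigr => c _.
Qed.

(** [psi \o g] is a surjective endomorphism sending the generators into the augmentation ideal, so
    [skew_hopfian] applies. *)
Lemma leading_inj : injective g.
Proof.
have hpg : alg_hom (psi \o g) by exact: alg_hom_comp.
have h0 : forall r, psi (g r) = 0 -> r = 0.
  apply: (skew_hopfian hq hpg) => [i|w].
    by rewrite /= ge; apply/sord1_psi/leading_z.
  by have [r Hr] := leading_surj (phi w); exists r; rewrite /= Hr phiK.
move=> r r' E; apply/eqP; rewrite -subr_eq0; apply/eqP/h0.
by rewrite (alg_homB hg) E subrr (alg_hom0 hpsi).
Qed.

Lemma leading_neq0 j : b j != 0.
Proof.
apply: contraNneq hT => bj; rewrite (expand_det_row _ j) big1 // => i _.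
by rewrite mxE bj (alg_hom0 hpsi) scoef0 mul0r.
Qed.

(** With both factors in the augmentation ideal, [psi (b j)] would have no linear part and row [j]
    of [T] would vanish. *)
Lemma leading_indecomposable j s t : b j = s * t -> bm 0 0 s = 0 -> bm 0 0 t <> 0.
Proof.
move=> bj zs zt; apply/negP: hT; rewrite negbK; apply/eqP.
rewrite (expand_det_row _ j) big1 // => i _; rewrite mxE bj (alg_homM hpsi).
have h : sord (1 + 1) (psi s * psi t) by apply: sordM; apply: sord1_psi.
by rewrite h ?mdeg1 // mul0r.
Qed.

(** The square of the augmentation ideal has no component of bidegree (0,1), so ['X] needs some
    [b j] of that bidegree. *)
Lemma leading_X : exists j, f j = (0%N, 1%N).
Proof.
have [c [w [ec hw]]] := leading_split (psi 'X).
have z0X : bm 0 0 'X = 0 by rewrite /bimono /bicomp coefX decomp0 coef0 mul0r.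
have : bm 0 1 (phi (psi 'X)) != 0 by rewrite psiK bimonoX01 polyX_eq0.
have zw : bm 0 1 (phi w) = 0.
  move: w hw {ec}; apply: (sord2_ind hq) => [|a w w' Hw Hw'|i w hw].
  - by rewrite (alg_hom0 hphi) bimono0.
  - rewrite (alg_homD hphi) (alg_homZ hphi) bimonoD bimonoZ Hw Hw' apolyZE mulr0.
    by rewrite addr0.
  (* The (0,1) component of a product has two terms, each containing a vanishing constant
     component. *)
  rewrite (alg_homM hphi) bimonoM !big_ord_recl !big_ord0 /= !addr0.
  by rewrite z0 mul0r add0r bimono00_phi hw ?mdeg0 // scale0r mulr0.
rewrite {1}ec (sord1_psi z0X) ?mdeg0 // scale0r add0r (alg_homD hphi) bimonoD zw addr0.
rewrite (alg_hom_sum hphi) bimono_sum => nz.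
have [j Hj] : exists j, bm 0 1 (phi (c j *: psi (b j))) != 0.
  apply/existsP; apply: contraNT nz => /existsPn h.
  by rewrite big1 // => j _; apply/eqP; have := h j; rewrite negbK.
exists j; move: Hj; rewrite (alg_homZ hphi) bimonoZ psiK /b bimono_mono.
case: ifP => [/andP[/eqP h1 /eqP h2] _|_]; last by rewrite apolyZE mulr0 eqxx.
by case: (f j) h1 h2 => /= ? ? <- <-.
Qed.

Lemma leading_shape : exists (j0 : 'I_n) (w : k),
  [/\ w != 0, b j0 = (w%:A)%:P * 'X & forall j, j != j0 -> exists y : B, b j = y%:P].
Proof.
have [j0 f0] := leading_X; exists j0.
have shape01 j : f j = (0%N, 1%N) -> exists w : k, b j = (w%:A)%:P * 'X.
  move=> fj; rewrite /b fj /bimono /bicomp /= expr1.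
  by have [w ->] := decomp_coef0 hB (phi (e j) : {poly B})`_1; exists w.
have [w bw] := shape01 j0 f0; exists w.
have w0 : w != 0.
  by apply: contraNneq (leading_neq0 j0) => w0; rewrite bw w0 scale0r mul0r.
split=> // j jj0.
have [m0|m0] := posnP (f j).2.
  by exists (bc (f j).1 0 (phi (e j))); rewrite /b /bimono m0 expr0 mulr1.
(* A second scalar multiple of ['X] would be proportional to [b j0], against the injectivity of
   [g]. *)
have [fj|fj] := eqVneq (f j) (0%N, 1%N).
  have [w' bw'] := shape01 j fj.
  have /leading_inj h : g (w *: e j) = g (w' *: e j0).
    rewrite !(alg_homZ hg) !ge bw bw' !apolyZE !mulrA -!polyCM !mulr_algl !scalerA.
    by rewrite mulrC.
  have := congr1 (scoef U_(j)%MM) h; rewrite !scoefZ !scoef_gen eqxx.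
  by rewrite eq_mnm1 eq_sym (negPf jj0) mulr0 mulr1 => /eqP; rewrite (negPf w0).
(* In the remaining case [b j] is ['X] times a cofactor of nonzero bidegree, which
   [leading_indecomposable] forbids. *)
have zX : bm 0 0 'X = 0 by rewrite /bimono /bicomp coefX decomp0 coef0 mul0r.
case: (@leading_indecomposable j 'X ((bc (f j).1 (f j).2 (phi (e j)))%:P * 'X^((f j).2.-1))).
- by rewrite /b /bimono -{2}(prednK m0) exprSr mulrA commr_polyX.
- exact: zX.
apply: bimono00_mono; apply: contraNT fj; rewrite negb_or !negbK => /andP[d0 m1].
by apply/eqP; case: (f j) d0 m0 m1 => [? [|[|?]]] //= /eqP->.
Qed.

Lemma leading_iso : exists (G : R -> apoly B) (j0 : 'I_n) (w : k),
  [/\ alg_hom G, bijective G, w != 0, G (e j0) = (w%:A)%:P * 'X &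
      forall j, j != j0 -> exists y : B, G (e j) = y%:P].
Proof.
have [j0 [w [w0 bw bj]]] := leading_shape; exists g, j0, w; split=> //.
- exact: bij_choice leading_inj leading_surj.
- by rewrite ge.
- by move=> j /bj; rewrite ge.
Qed.

End Augmented.

(** * Exchanging the central generator with t *)

Section Cancellation.
Variables (k : fieldType) (p : 'I_3 -> 'I_3 -> k) (A B : algType k) (x : 'I_3 -> A).
Hypotheses (hp : skew_params p) (hA : is_skew_poly_ring p x).
Local Notation q := (ext_params p).
Local Notation e := (skew_gen q).

Variables (g : skewpoly q -> apoly B) (g' : apoly B -> skewpoly q) (j0 : 'I_4) (w : k).
Hypotheses (hg : alg_hom g) (gK : cancel g g') (g'K : cancel g' g).
Hypotheses (gj0 : g (e j0) = (w%:A)%:P * 'X)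
  (gj : forall j, j != j0 -> exists y : B, g (e j) = y%:P).

Let hq : q_params q. Proof. exact: ext_params_q. Qed.

(** [g (e j0)] is a scalar multiple of the central ['X]; the parameter is read off from the
    coefficient of the monomial in [e j0] and [e j]. *)
Lemma special_central j : q j0 j = 1.
Proof.
have gC : g (e j) * g (e j0) = g (e j0) * g (e j).
  rewrite gj0; apply/polyP => i.
  by rewrite mulrA coefMX -mulrA -commr_polyX mulrA coefMX coefCM coefMC mulr_algl mulr_algr.
have E : e j * e j0 = e j0 * e j by apply: (can_inj gK); rewrite !(alg_homM hg).
have := skew_gen_rel hq j0 j; rewrite E => /(congr1 (scoef (U_(j0) + U_(j))%MM)).
rewrite scoefZ skewXM scoefZ scoefX eqxx mulr1 => /eqP.
rewrite -[X in X == _]mul1r -subr_eq0 -mulrBl mulf_eq0 subr_eq0 eq_sym.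
by rewrite (negPf (twist_unit hq _ _)) orbF => /eqP.
Qed.

(** An enumeration of the indices other than [j0]: unless [j0] is the last index, the index of t
    takes its place. *)
Let s (a : 'I_3) : 'I_4 :=
  if lift ord_max a == j0 then ord_max else lift ord_max a.

Let s_neq a : s a != j0.
Proof.
rewrite /s; case: (eqVneq (lift ord_max a) j0) => [<-|//]; exact: neq_lift.
Qed.

Let s_inj : injective s.
Proof.
move=> a b; rewrite /s.
case: eqVneq => [ea|_]; case: eqVneq => [eb|_]; last exact: lift_inj.
- by move=> _; apply: (@lift_inj _ ord_max); rewrite ea eb.
- by move/eqP; rewrite (negPf (neq_lift _ _)).
- by move/esym/eqP; rewrite (negPf (neq_lift _ _)).
Qed.

Let s_onto j : j != j0 -> exists a, s a = j.
Proof.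
case: (unliftP ord_max j) => [a|] -> jj0.
  by exists a; rewrite /s (negPf jj0).
move: jj0; rewrite eq_sym => jj0; case: (unliftP ord_max j0) => [a ea|ea].
  by exists a; rewrite /s ea eqxx.
by rewrite ea eqxx in jj0.
Qed.

(** [j0] and [ord_max] both have trivial parameters, so replacing one by the other changes
    nothing. *)
Let s_params a b : q (s a) (s b) = p a b.
Proof.
have q0 j : q j j0 = 1 by have := hq.2 j0 j; rewrite special_central mul1r.
rewrite -[RHS]ext_params_lift /s.
case: eqVneq => [->|_]; first by rewrite ext_params_maxl special_central.
by case: eqVneq => [->|_]; first by rewrite ext_params_maxr q0.
Qed.

(** Images of the generators under a retraction onto [A] that kills [e j0]. *)
Let retr_gens (j : 'I_4) : A := if [pick a | s a == j] is Some a then x a else 0.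

Let retr_gens_s a : retr_gens (s a) = x a.
Proof.
rewrite /retr_gens; case: pickP => [b /eqP/s_inj->//|/(_ a)].
by rewrite eqxx.
Qed.

Let retr_gens_j0 : retr_gens j0 = 0.
Proof. by rewrite /retr_gens; case: pickP => // a; rewrite (negPf (s_neq a)). Qed.

Let retr_rel : q_rel q retr_gens.
Proof.
move=> i j; have [->|/s_onto[a <-]] := eqVneq i j0.
  by rewrite retr_gens_j0 mulr0 mul0r scaler0.
have [->|/s_onto[b <-]] := eqVneq j j0.
  by rewrite retr_gens_j0 mulr0 mul0r scaler0.
rewrite !retr_gens_s s_params; exact: hA.1.
Qed.

(* The three generators of {poly B} other than the multiple of 'X lie in B and
   generate it; since x_j0 is central, 'X may play its role in A. *)
Lemma cancel_base : alg_iso A B.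
Proof.
have [_ univ] := hA.
pose rho : skewpoly q -> A := skew_eval (p := q) retr_gens.
have hrho : alg_hom rho := skew_eval_hom hq retr_rel.
have rho_e j : rho (e j) = retr_gens j := skew_eval_gen retr_rel j.
have [theta [htheta theta_x]] : exists f : A -> skewpoly q,
    alg_hom f /\ forall a, f (x a) = e (s a).
  by apply: (univ _ _ _).1 => a b; rewrite (skew_gen_rel hq) s_params.
have hrt : alg_hom (rho \o theta) := alg_hom_comp htheta hrho.
have hid : alg_hom (id : A -> A) by [].
have rt a : rho (theta a) = a.
  apply: ((univ A x hA.1).2 _ _ hrt hid) => i.
  by rewrite /= theta_x rho_e retr_gens_s.
pose f : A -> B := (fun P : {poly B} => P`_0) \o g \o theta.
have hgt : alg_hom (g \o theta) := alg_hom_comp htheta hg.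
have hf : alg_hom f := alg_hom_comp hgt (coef0_hom B).
have hfC : alg_hom (polyC \o f : A -> apoly B) := alg_hom_comp hf (polyC_hom B).
have xrel : skew_rel p (fun a => g (theta (x a))).
  by move=> a b; rewrite -!(alg_homM hgt) hA.1 (alg_homZ hgt).
(* [theta] avoids [e j0], and [g] sends the other generators to constants. *)
have gt a : g (theta a) = (f a)%:P.
  apply: ((univ _ _ xrel).2 _ _ hgt hfC) => i /=.
  rewrite /f /= theta_x; have [y ->] := gj (s_neq i).
  by rewrite coefC.
have h1 : alg_hom ((fun P : {poly B} => P`_0) \o g) := alg_hom_comp hg (coef0_hom B).
have h2 : alg_hom (f \o rho) := alg_hom_comp hrho hf.
(* Killing [e j0] corresponds to setting t to zero, because its image is a multiple of ['X]. *)
have fr r : f (rho r) = (g r : {poly B})`_0.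
  apply/esym/(skew_hom_eq hq h1 h2) => j /=.
  have [->|/s_onto[a <-]] := eqVneq j j0.
    by rewrite gj0 rho_e retr_gens_j0 (alg_hom0 hf) coefMX.
  by rewrite rho_e retr_gens_s /f /= theta_x.
exists f; split=> //; exists (fun b => rho (g' b%:P)) => [a|b].
  by rewrite -gt gK rt.
by rewrite fr g'K coefC.
Qed.

End Cancellation.

Theorem theorem4p14 (k : fieldType) (char0 : [pchar k] =i pred0)
    (p : 'I_3 -> 'I_3 -> k) (hp : skew_params p)
    (hPI : roots_of_unity_params p)
    (A : algType k) (x : 'I_3 -> A) (hA : is_skew_poly_ring p x)
    (B : algType k) (V : nat -> B -> Prop) (hB : connected_graded V) :
  poly_alg_iso A B -> alg_iso A B.
Proof.
case=> phi [phiD phiM phi1 phiZ phi_bij].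
have hphi : alg_hom (phi : apoly A -> apoly B) by split.
have [F [hF F_bij _]] := skew_poly_ext hp hA.
have hq : q_params (ext_params p) := ext_params_q hp.
have [H [G [hH HK GK z0]]] :=
  augmented_iso hB hq (alg_hom_comp hF hphi) (bij_comp phi_bij F_bij).
have [f hf] := nonsingular_components hB hH HK GK.
have [g [j0 [w [hg [g' gK g'K] _ gj0 gj]]]] := leading_iso hq hH HK GK z0 hf.
exact: (cancel_base hp hA hg gK g'K gj0 gj).
Qed.
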